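(* Let $\Omega\subset\mathbb{R}^3$ be a bounded closed domain with piecewise smooth boundary, and let $G=S+R$ be a decomposition of the Dirichlet Green's function $G$ of $\Omega$ into a singular part $S$ and a regular part $R$. Assume that for every fixed $y\in\Omega$ the function $R(\cdot,y)$ is harmonic in an open domain $U\subset\mathbb{R}^3$ such that $\Omega\subset U$. Let $f\in L^2(\partial\Omega)$ and let $u$ be the solution of the Dirichlet problem $\Delta u=0$ in the interior of $\Omega$, $u=f$ on $\partial\Omega$. Define $$H_S(x)=-\int_{\partial\Omega}\frac{\partial S}{\partial n_y}(x,y)\,f(y)\,ds_y,\qquad H_R(x)=-\int_{\partial\Omega}\frac{\partial R}{\partial n_y}(x,y)\,f(y)\,ds_y .$$ Then the solution admits the decomposition $u(x)=H_S(x)+H_R(x)$ for $x$ in the interior of $\Omega$, where: (A) $H_R$ is harmonic in $U$. (B) All singular behavior of the solution $u$ is contained in $H_S$; that is, the difference $u-H_S$ on the interior of $\Omega$ is the restriction of a function that is harmonic in all of $U$.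
   Context: The Dirichlet Green's function $G(x,y)$ of $\Omega$ is the function satisfying $\Delta_y G(x,y)=-\delta(x-y)$ for $y$ in the interior of $\Omega$ and $G(x,y)=0$ for $y\in\partial\Omega$, where $\delta$ is the Dirac delta distribution and $\Delta_y$ is the Laplacian in $y$. The vector $n_y$ is the outward unit normal at $y\in\partial\Omega$, $\partial/\partial n_y$ is differentiation with respect to $y$ in that direction, and $ds_y$ is surface measure. The solution $u$ of the Dirichlet problem with data $f$ is given by Green's representation $$u(x)=-\int_{\partial\Omega}\frac{\partial G}{\partial n_y}(x,y)\,f(y)\,ds_y,\qquad x \text{ in the interior of }\Omega.$$ The decomposition is $G(x,y)=S(x,y)+R(x,y)$, where $S$ represents the singular part of $G$ and $R$ its regular part; $R(x,y)$ is defined for $x\in U$ and $y\in\Omega$.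
   Formalization: ''Regular part'' is made precise by an added assumption: R(x,y) is C^1 in y up to smooth boundary points, with y-gradient jointly continuous in (x,y), and its normal derivative is in L^2 of the boundary locally uniformly for x in U; without this H_R may fail to be harmonic. *)

(* Defs.v *)
From HB Require Import structures.
From mathcomp Require Import all_boot all_order all_algebra.
From mathcomp Require Import all_classical all_reals all_analysis.
Import Order.TTheory GRing.Theory Num.Theory.
Import numFieldNormedType.Exports.

Set Implicit Arguments.
Unset Strict Implicit.
Unset Printing Implicit Defensive.

Local Open Scope classical_set_scope.
Local Open Scope ring_scope.

(* Triples rather than row vectors, so that the product Lebesgue measure
   applies.  The library norm on products is the max norm; it is used here
   for the topology only, and lengths and angles always come from [dot]. *)
Definition R2 (R : realType) := (R * R)%type.
Definition R3 (R : realType) := (R * R * R)%type.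

(* [measurableTypeR R] is R with its Borel sigma-algebra. *)
Definition leb2 (R : realType) :
    {measure set (measurableTypeR R * measurableTypeR R) -> \bar R} :=
  (@lebesgue_measure R \x @lebesgue_measure R)%E.
Definition leb3 (R : realType) :
    {measure set (measurableTypeR R * measurableTypeR R * measurableTypeR R)
       -> \bar R} :=
  ((@lebesgue_measure R \x @lebesgue_measure R) \x @lebesgue_measure R)%E.

Section Defs.
Variable R : realType.
Notation R2 := (R2 R).
Notation R3 := (R3 R).

Definition dot (u v : R3) : R := u.1.1 * v.1.1 + u.1.2 * v.1.2 + u.2 * v.2.
Definition enorm (u : R3) : R := Num.sqrt (dot u u).
Definition cross (u v : R3) : R3 :=
  (u.1.2 * v.2 - u.2 * v.1.2, u.2 * v.1.1 - u.1.1 * v.2,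
   u.1.1 * v.1.2 - u.1.2 * v.1.1).

Definition basis3 (i : 'I_3) : R3 :=
  ((i == 0%N :> nat)%:R, (i == 1%N :> nat)%:R, (i == 2%N :> nat)%:R).

(* Class C^k on D; meant for open D, where continuity at every point of D and
   continuity of the restriction to D coincide. *)
Fixpoint classC (k : nat) (D : set R3) (g : R3 -> R) : Prop :=
  (forall x, D x -> {for x, continuous g}) /\
  if k is k'.+1 then
    forall i, (forall x, D x -> derivable g x (basis3 i)) /\
              classC k' D ('D_(basis3 i) g)
  else True.

Definition laplacian (g : R3 -> R) (x : R3) : R :=
  \sum_(i < 3) 'D_(basis3 i) ('D_(basis3 i) g) x.

Definition harmonic_on (D : set R3) (g : R3 -> R) : Prop :=
  classC 2 D g /\ forall x, D x -> laplacian g x = 0.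

Definition test_function (D : set R3) (g : R3 -> R) : Prop :=
  (forall k, classC k setT g) /\
  exists K, [/\ compact K, K `<=` D & forall x, ~ K x -> g x = 0].

Definition boundary (A : set R3) : set R3 := closure A `\` A°.

(* The closure of a bounded connected nonempty open set. *)
Definition bounded_closed_domain (A : set R3) : Prop :=
  [/\ compact A, A° !=set0, connected A° & closure A° = A].

(* A has at y a tangent half-space with unit outer vector n: approached inside
   any cone strictly on one side of the plane orthogonal to n, the points near
   y are outside A, resp. interior to A.  Such n is unique. *)
Definition is_outward_normal (A : set R3) (y n : R3) : Prop :=
  dot n n = 1 /\
  forall e : R, 0 < e -> \forall v \near (0 : R3),
    (e * enorm v < dot v n -> ~ A (y + v)) /\
    (dot v n < - (e * enorm v) -> A° (y + v)).

Definition outward_normal (A : set R3) (y : R3) : R3 :=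
  xget 0 [set n | is_outward_normal A y n].

(* One-sided, because the functions differentiated are given on A only. *)
Definition normal_quotient (A : set R3) (g : R3 -> R) (y : R3) (t : R) : R :=
  (g y - g (y - t *: outward_normal A y)) / t.

Definition normal_derivable (A : set R3) (g : R3 -> R) (y : R3) : Prop :=
  cvg (normal_quotient A g y t @[t --> 0^'+]).

Definition normal_derivative (A : set R3) (g : R3 -> R) (y : R3) : R :=
  lim (normal_quotient A g y t @[t --> 0^'+]).

Definition osquare : set R2 := [set p | 0 < p.1 < 1 /\ 0 < p.2 < 1].
Definition csquare : set R2 := [set p | 0 <= p.1 <= 1 /\ 0 <= p.2 <= 1].

Definition classC1_at (phi : R2 -> R3) (p : R2) : Prop :=
  [/\ \forall q \near p, differentiable phi q,
      {for p, continuous ('D_(1, 0) phi)} &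
      {for p, continuous ('D_(0, 1) phi)}].

Definition chart_normal (phi : R2 -> R3) (p : R2) : R3 :=
  cross ('D_(1, 0) phi p) ('D_(0, 1) phi p).

Definition area_density (phi : R2 -> R3) (p : R2) : R :=
  enorm (chart_normal phi p).

(* The boundary is cut into finitely many C^1 patches, parametrized by the
   closed unit square and positively oriented, which overlap along their edges
   only.  A parametrization may degenerate on the edges of the square (polar
   coordinates, apex of a cone). *)
Definition piecewise_smooth_boundary (A : set R3) (m : nat)
    (phi : 'I_m -> R2 -> R3) : Prop :=
  [/\ boundary A = \bigcup_i (phi i @` csquare),
      forall i p, csquare p -> classC1_at (phi i) p,
      forall i p, osquare p -> chart_normal (phi i) p != 0,
      forall i j p q, osquare p -> osquare q ->
        phi i p = phi j q -> i = j /\ p = q &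
      forall i p, osquare p -> is_outward_normal A (phi i p)
        ((area_density (phi i) p)^-1 *: chart_normal (phi i) p)].

Section Surface.
Variables (m : nat) (phi : 'I_m -> R2 -> R3).

Definition smooth_boundary_points : set R3 := \bigcup_i (phi i @` osquare).

Definition surface_integral (g : R3 -> R) : R :=
  \sum_(i < m)
    (\int[leb2 R]_(p in osquare) (g (phi i p) * area_density (phi i) p))%R.

Definition surface_integrable (g : R3 -> R) : Prop :=
  forall i, (leb2 R).-integrable osquare
    (fun p => (g (phi i p) * area_density (phi i) p)%:E).

(* The squared L^2 norm for surface measure. *)
Definition surface_sqnorm (g : R3 -> R) : \bar R :=
  (\sum_(i < m)
    \int[leb2 R]_(p in osquare)
      ((g (phi i p)) ^+ 2 * area_density (phi i) p)%:E)%E.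

Definition surface_L2 (g : R3 -> R) : Prop :=
  (forall i, measurable_fun (osquare : set (measurableTypeR R * measurableTypeR R))
               (g \o phi i : _ -> measurableTypeR R)) /\
  (surface_sqnorm g < +oo)%E.

(* The area density being positive on the open square, null sets of parameters
   and null sets for surface measure correspond. *)
Definition surface_ae (P : R3 -> Prop) : Prop :=
  forall i, {ae leb2 R, forall p, osquare p -> P (phi i p)}.

Definition layer (A : set R3) (F : R3 -> R3 -> R) (f : R3 -> R) (x : R3) : R :=
  - surface_integral (fun y => normal_derivative A (F x) y * f y).

Definition layer_defined (A : set R3) (F : R3 -> R3 -> R) (f : R3 -> R)
    (x : R3) : Prop :=
  (forall y, smooth_boundary_points y -> normal_derivable A (F x) y) /\
  surface_integrable (fun y => normal_derivative A (F x) y * f y).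

Definition green_representation (A : set R3) (G : R3 -> R3 -> R)
    (f u : R3 -> R) : Prop :=
  forall x, A° x -> layer_defined A G f x /\ u x = layer A G f x.

(* For square-integrable data the boundary values are attained almost
   everywhere, along the normal. *)
Definition dirichlet_problem (A : set R3) (f u : R3 -> R) : Prop :=
  harmonic_on A° u /\
  surface_ae (fun y => u (y - t *: outward_normal A y) @[t --> 0^'+] --> f y).

(* Regularity of the part R of G: up to the smooth points of the boundary, it
   is C^1 in y with gradient DF jointly continuous in (x, y), and its normal
   derivative is square-integrable, locally uniformly in x. *)
Definition regular_part (U A : set R3) (F : R3 -> R3 -> R) : Prop :=
  let A' := A° `|` smooth_boundary_points in
  [/\ forall x, U x -> {within A', continuous (F x)},
      exists DF : R3 * R3 -> R3,
        {within U `*` A', continuous DF} /\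
        forall x y v, U x -> A° y -> is_derive y v (F x) (dot (DF (x, y)) v) &
      forall x0, U x0 -> exists M : R, \forall x \near x0,
        (surface_sqnorm (normal_derivative A (F x)) <= M%:E)%E].

End Surface.

(* The equation for G is in the sense of distributions on the interior.  The
   value G x x is irrelevant. *)
Definition dirichlet_green (A : set R3) (G : R3 -> R3 -> R) : Prop :=
  forall x, A° x ->
  [/\ {within A `\ x, continuous (G x)},
      forall y, boundary A y -> G x y = 0,
      forall K, compact K -> K `<=` A° ->
        (leb3 R).-integrable K (fun y => (G x y)%:E) &
      forall g, test_function A° g ->
        (\int[leb3 R]_(y in A°) (G x y * laplacian g y))%R = - g x].

Definition green_decomposition (A : set R3) (G S F : R3 -> R3 -> R) : Prop :=
  forall x y, A° x -> A y -> y != x -> G x y = S x y + F x y.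

End Defs.

(* Main.v *)
Require Import Defs.
From HB Require Import structures.
From mathcomp Require Import all_boot all_order all_algebra.
From mathcomp Require Import all_classical all_reals all_analysis.
From mathcomp Require Import measurable_realfun.
From mathcomp Require Import ring lra.
Import Order.TTheory GRing.Theory Num.Theory.
Import numFieldNormedType.Exports.
Local Open Scope classical_set_scope.
Local Open Scope ring_scope.

(* The normal derivative of R(x,.) at a smooth boundary point y is, locally
   uniformly in x, the limit of the difference quotients
   (R(x,y) - R(x,y-tn))/t, which are harmonic in x.  H_R is in turn a locally
   uniform limit of finite linear combinations of such normal derivatives, so
   everything rests on the closure of harmonic functions under locally uniform
   limits.  That closure needs no integral representation: the maximum
   principle, applied to the odd part of a harmonic function in a half cube and
   an explicit barrier, bounds its gradient by its supremum, and applied again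
   to difference quotients it bounds the second derivatives, so that uniform
   approximation carries over to all derivatives up to order two.  Finally S =
   G - R near the boundary, so u - H_S = H_R in the interior. *)

Set Implicit Arguments.
Unset Strict Implicit.
Unset Printing Implicit Defensive.

(** * Derivatives along lines *)

(** Three features of the setting shape the proof. [harmonic_on] asks for continuous second
    derivatives, so a uniform limit has to be shown twice differentiable: the maximum principle
    alone is not enough, and explicit bounds on first and second derivatives are required. The norm
    on triples is the max norm, so balls are cubes; coordinate reflections preserve them, and a
    quadratic polynomial with negative Laplacian is large enough on all outer faces of a half cube.
    Charts may degenerate on the edges of the parameter square, so near the edges the kernel of H_R
    is controlled only by its L^2 norm; uniform approximation in the parameter is therefore made on
    smaller closed squares, and the square-integrability of [f] absorbs the rest. Finally, [S] is
    accessible only as [G] minus [Rg] away from the diagonal. The existence of its normal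
    derivatives and the integrability of its layer are thus inferred from those of [G] and [Rg], by
    subtraction. *)

Lemma is_deriveP (R : realType) (V : normedModType R) (g : V -> R) x v d :
  is_derive x v g d <->
  (fun h => h^-1 *: (g (h *: v + x) - g x)) @ 0^' --> d.
Proof.
split=> [[gx <-]|gd]; first exact: gx.
by split; [apply/cvg_ex; exists d|exact: cvg_lim gd].
Qed.

Lemma is_derive_line (R : realType) (V : normedModType R) (g : V -> R) x v d t :
  is_derive (x + t *: v) v g d -> is_derive t 1 (fun s => g (x + s *: v)) d.
Proof.
move=> /is_deriveP gd; apply/is_deriveP; apply: cvg_trans gd.
apply: near_eq_cvg; near=> h; congr (_ *: (g _ - _)).
by rewrite scalerDl [h *: 1]mulr1 addrCA.
Unshelve. all: by end_near. Qed.

Lemma is_derive_continuous (R : realType) (h : R -> R) (s d : R) :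
  is_derive s 1 h d -> {for s, continuous h}.
Proof. by case=> /derivable1_diffP/differentiable_continuous. Qed.

Lemma MVT_is_derive (R : realType) (h h' : R -> R) (s : R) : 0 < s ->
  (forall t : R, 0 < t < s -> is_derive t 1 h (h' t)) ->
  {within `[0, s], continuous h} ->
  exists2 t, 0 < t < s & h s - h 0 = h' t * s.
Proof.
move=> s0 dh ch.
have dh' (t : R) : t \in `]0, s[ -> is_derive t 1 h (h' t).
  by rewrite in_itv/= => /dh.
have [t] := MVT s0 dh' ch.
by rewrite in_itv/= subr0 => ht; exists t.
Qed.

(** At the maximum [h' 0 = 0]. If [c] were positive, [h'] would be positive just to the right of 0,
    and the mean value theorem would push [h] above [h 0]. *)
Lemma second_derivative_at_max (R : realType) (h h' : R -> R) (c d : R) : 0 < d ->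
  (forall s : R, `|s| < d -> is_derive s 1 h (h' s)) ->
  is_derive (0 : R) 1 h' c ->
  (forall s : R, `|s| < d -> h s <= h 0) -> c <= 0.
Proof.
move=> d0 hh' h'c hmax; rewrite leNgt; apply/negP => c0.
have h'0 : h' 0 = 0.
  have dm s : s \in `](- d), d[ -> `|s| < d by rewrite in_itv/= ltr_norml.
  have : is_derive (0 : R) 1 h 0.
    apply: (@derive1_at_max _ h (- d) d 0).
    - by rewrite ltW// gtrN.
    - by move=> s /dm/hh'[].
    - by rewrite in_itv/= oppr_lt0 d0.
    - by move=> s /dm/hmax.
  have := hh' 0; rewrite normr0 => /(_ d0) [_ <-] [_].
  by [].
have /is_deriveP := h'c; rewrite h'0.
move=> /cvgrPdist_lt /(_ _ c0).
rewrite near_withinE => -[e/= e0 he].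
pose s := Num.min d e / 2.
have s0 : 0 < s by rewrite divr_gt0// lt_min d0.
have m0 : 0 < Num.min d e by rewrite lt_min d0.
have [sd se] : s < d /\ s < e.
  have : Num.min d e <= d by rewrite ge_min lexx.
  have : Num.min d e <= e by rewrite ge_min lexx orbT.
  by rewrite /s; split; lra.
have ds t : 0 <= t <= s -> `|t| < d.
  by move=> /andP[t0 ts]; rewrite ger0_norm//; lra.
have dh (t : R) : 0 < t < s -> is_derive t 1 h (h' t).
  by move=> /andP[t0 ts]; apply/hh'/ds; lra.
have ch : {within `[0, s], continuous h}.
  apply: continuous_in_subspaceT => t; rewrite inE/= in_itv/= => /ds/hh'.
  exact: is_derive_continuous.
have [t /andP[t0 ts] ht] := MVT_is_derive s0 dh ch.
have h't : 0 < h' t.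
  have := he t; rewrite /= sub0r normrN gtr0_norm// => /(_ (lt_trans ts se)).
  rewrite lt0r_neq0// => /(_ erefl); rewrite subr0 addr0 [t *: 1]mulr1.
  rewrite [_ *: _]mulrC => /ltr_normlW; rewrite ltrBlDl -ltrBlDr subrr.
  by rewrite pmulr_lgt0// invr_gt0.
have : h s <= h 0 by apply/hmax/ds; lra.
by rewrite -subr_le0 ht leNgt mulr_gt0.
Qed.

(** * Gradient bound for harmonic functions *)

Section coordinates.
Variable R : realType.
Implicit Types (x y z u v : R3 R) (i j : 'I_3) (s : R).
Local Notation e_ := (basis3 R).

(** Coordinates are indexed through [dot] so that one argument covers all three directions; [coordE]
    goes back to the projections. *)
Definition coord i z : R := dot z (e_ i).

Definition reflection i z : R3 R := z - (2 * coord i z) *: e_ i.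

Lemma ord3_ind (P : 'I_3 -> Prop) :
  P ord0 -> P (lift ord0 ord0) -> P ord_max -> forall i, P i.
Proof.
move=> P0 P1 P2 [[|[|[|//]]] lti3].
- by rewrite (_ : Ordinal _ = ord0)//; apply: val_inj.
- by rewrite (_ : Ordinal _ = lift ord0 ord0)//; apply: val_inj.
- by rewrite (_ : Ordinal _ = ord_max)//; apply: val_inj.
Qed.

Lemma coordE z : (coord ord0 z = z.1.1) * (coord (lift ord0 ord0) z = z.1.2) *
  (coord ord_max z = z.2).
Proof. by rewrite /coord /dot /=; do !split; ring. Qed.

Lemma coord_basis i j : coord i (e_ j) = (i == j)%:R.
Proof.
by elim/ord3_ind: i; elim/ord3_ind: j; rewrite coordE.
Qed.

Lemma coord0 i : coord i 0 = 0.
Proof. by rewrite /coord /dot/= !mul0r !addr0. Qed.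

Lemma coordD i x y : coord i (x + y) = coord i x + coord i y.
Proof. by rewrite /coord /dot /=; ring. Qed.

Lemma coordZ i s x : coord i (s *: x) = s * coord i x.
Proof. by rewrite /coord /dot /= /GRing.scale/=; ring. Qed.

Lemma coordN i x : coord i (- x) = - coord i x.
Proof. by rewrite -scaleN1r coordZ mulN1r. Qed.

Lemma coordB i x y : coord i (x - y) = coord i x - coord i y.
Proof. by rewrite coordD coordN. Qed.

Lemma le_coord_norm i z : `|coord i z| <= `|z|.
Proof.
elim/ord3_ind: i; rewrite coordE !prod_normE !le_max lexx ?orbT//.
Qed.

Lemma norm_coord z : exists i, `|z| = `|coord i z|.
Proof.
rewrite !prod_normE.
case: (leP (Num.max `|z.1.1| `|z.1.2|) `|z.2|) => _.
  by exists ord_max; rewrite coordE.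
case: (leP `|z.1.1| `|z.1.2|) => _.
  by exists (lift ord0 ord0); rewrite coordE.
by exists ord0; rewrite coordE.
Qed.

Lemma eq_norm_coord z z' :
  (forall i, `|coord i z| = `|coord i z'|) -> `|z| = `|z'|.
Proof.
move=> zz'; have := zz' ord0; have := zz' (lift ord0 ord0).
by have := zz' ord_max; rewrite !coordE !prod_normE => -> -> ->.
Qed.

Lemma norm_basis i : `|e_ i| = 1.
Proof.
apply/eqP; rewrite eq_le; apply/andP; split; last first.
  by have := le_coord_norm i (e_ i); rewrite coord_basis eqxx normr1.
have [j ->] := norm_coord (e_ i); rewrite coord_basis.
by case: eqP; rewrite ?normr1// normr0.
Qed.

Lemma coord_reflection i j z :
  coord j (reflection i z) = if i == j then - coord j z else coord j z.
Proof.
rewrite /reflection coordB coordZ coord_basis [j == i]eq_sym.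
by case: eqP => [->|_] /=; ring.
Qed.

Lemma norm_reflection i z : `|reflection i z| = `|z|.
Proof.
by apply: eq_norm_coord => j; rewrite coord_reflection; case: ifP; rewrite ?normrN.
Qed.

Lemma reflection_line i j z s : reflection i (z + s *: e_ j) =
  reflection i z + ((if i == j then -1 else 1) * s) *: e_ j.
Proof.
rewrite /reflection coordD coordZ coord_basis mulrDr scalerDl opprD.
rewrite [LHS]addrACA; congr (_ + _); case: eqP => [->|_] /=.
  by rewrite -scaleNr -scalerDl; congr (_ *: _); ring.
by rewrite mulr0 mulr0 scale0r subr0 mul1r.
Qed.

Lemma continuous_coord i : continuous (coord i).
Proof.
move=> z; apply/cvgrPdist_lt => e e0; near=> x.
rewrite -coordB (le_lt_trans (le_coord_norm _ _))//.
Unshelve. all: by end_near. Qed.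

Lemma continuous_reflection i : continuous (reflection i).
Proof.
move=> z; apply: cvgB; first exact: cvg_id.
apply: cvgZr_tmp; apply: cvgMl_tmp; exact: continuous_coord.
Qed.

Lemma dotE x y : dot x y = \sum_i coord i x * coord i y.
Proof.
by rewrite !big_ord_recl big_ord0 /coord /dot /=; ring.
Qed.

Lemma cvg_dot (T : Type) (F : set_system T) (FF : Filter F) (f g : T -> R3 R) x y : 
  f @ F --> x -> g @ F --> y -> dot (f t) (g t) @[t --> F] --> dot x y.
Proof.
move=> fx gy; 
have fi i : coord i (f t) @[t --> F] --> coord i x.
  exact: (continuous_cvg _ (@continuous_coord i x) fx).
have gi i : coord i (g t) @[t --> F] --> coord i y.
  exact: (continuous_cvg _ (@continuous_coord i y) gy).
have -> : (fun t => dot (f t) (g t)) = (fun t : T =>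
    coord ord0 (f t) * coord ord0 (g t) +
    coord (lift ord0 ord0) (f t) * coord (lift ord0 ord0) (g t) +
    coord ord_max (f t) * coord ord_max (g t)).
  by apply/funext => t; rewrite !coordE.
have -> : dot x y = coord ord0 x * coord ord0 y +
    coord (lift ord0 ord0) x * coord (lift ord0 ord0) y +
    coord ord_max x * coord ord_max y by rewrite !coordE.
by apply: cvgD; [apply: cvgD; apply: cvgM|apply: cvgM].
Qed.

Lemma compact_max_ball r : compact [set z : R3 R | `|z| <= r].
Proof.
have -> : [set z : R3 R | `|z| <= r] =
    (`[- r, r]%classic `*` `[- r, r]%classic) `*` `[- r, r]%classic.
  apply/seteqP; split=> [[[a b] c]|[[a b] c]] /=;
  rewrite !prod_normE /= !ge_max !in_itv/= !ler_norml.
    by move=> /andP[/andP[-> ->] ->].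
  by move=> [[-> ->] ->].
by apply: compact_setX; [apply: compact_setX|]; exact: segment_compact.
Qed.

Lemma dot_ge0 x : 0 <= dot x x.
Proof. by rewrite dotE sumr_ge0// => i _; rewrite -expr2 sqr_ge0. Qed.

Lemma dot_ge_coord i x : coord i x ^+ 2 <= dot x x.
Proof.
by rewrite dotE (bigD1 i)//= expr2 lerDl sumr_ge0// => j _; rewrite -expr2 sqr_ge0.
Qed.

Lemma dot_line j z s : dot (z + s *: e_ j) (z + s *: e_ j) =
  dot z z + 2 * coord j z * s + s ^+ 2.
Proof.
elim/ord3_ind: j; rewrite !coordE /dot/= /GRing.scale/=; ring.
Qed.

End coordinates.

Section gradient_bound.
Variable R : realType.
Implicit Types (D : set (R3 R)) (g : R3 R -> R) (x y z : R3 R) (i j : 'I_3).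
Local Notation e_ := (basis3 R).

(* [harmonic_on] with the partial derivatives as witnesses, which makes linear
   combinations, translates and limits available without ever computing ['D_]. *)
Definition harmonic_jet D g (g1 : 'I_3 -> R3 R -> R)
    (g2 : 'I_3 -> 'I_3 -> R3 R -> R) :=
  forall x, D x ->
  [/\ {for x, continuous g},
      forall i, {for x, continuous (g1 i)} /\ is_derive x (e_ i) g (g1 i x),
      forall i j, {for x, continuous (g2 i j)} /\
                  is_derive x (e_ j) (g1 i) (g2 i j x) &
      \sum_(i < 3) g2 i i x = 0].

Lemma harmonic_onP D g : harmonic_on D g -> 
  exists (g1 : 'I_3 -> R3 R -> R) (g2 : 'I_3 -> 'I_3 -> R3 R -> R), harmonic_jet D g g1 g2.
Proof.
move=> [[gc gd] gl]; exists (fun i => 'D_(e_ i) g).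
exists (fun i j => 'D_(e_ j) ('D_(e_ i) g)).
move=> x Dx; split; [exact: gc| | |exact: gl].
  move=> i; have [gid [gic _]] := gd i; split; first exact: gic.
  exact/derivableP/gid.
move=> i j; have [_ [_ /(_ j)[gijd [gijc _]]]] := gd i.
by split; [exact: gijc|exact/derivableP/gijd].
Qed.

(* A multiple of [barrier d i] dominates the odd part of [g] in the i-th
   coordinate on the boundary of the half cube; its Laplacian is the negative
   constant -2. *)
Let barrier d i z := dot z z + 4 * coord i z * (d - coord i z).

(** Only the quadratic coefficient contributes to second derivatives, so the linear one is left
    existential. *)
Lemma barrier_line d i j z (s : R) : exists b, forall s,
  barrier d i (z + s *: e_ j) =
  barrier d i z + b * s + (1 - 4 * (i == j)%:R) * s ^+ 2.
Proof.
exists (2 * coord j z + 4 * (i == j)%:R * (d - 2 * coord i z)) => t.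
rewrite /barrier dot_line coordD coordZ coord_basis.
by case: eqP => _ /=; ring.
Qed.

Let sum_barrier i : \sum_(j < 3) (2 * (1 - 4 * (i == j)%:R)) = - 2 :> R.
Proof.
by rewrite !big_ord_recl big_ord0; elim/ord3_ind: i => /=; ring.
Qed.

Let sum_line (k l : R) (a b c : 'I_3 -> R) : \sum_j a j = 0 -> \sum_j b j = 0 ->
  \sum_j c j = l -> \sum_j (a j - b j - k * c j) = - (k * l).
Proof. by move=> a0 b0 cl; rewrite !sumrB a0 b0 -mulr_sumr cl subrr sub0r. Qed.

Lemma is_derive_quadratic (a b c s : R) :
  is_derive s 1 (fun t : R => a + b * t + c * t ^+ 2) (b + 2 * c * s).
Proof.
apply/is_derive1_caratheodory; exists (fun t => b + c * (t + s)).
split; [by move=> t; ring| |ring].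
apply: cvgD; first exact: cvg_cst.
by apply: cvgMl_tmp; apply: cvgD; [exact: cvg_id|exact: cvg_cst].
Qed.

Lemma is_derive_affine (a b s : R) : is_derive s 1 (fun t : R => a + b * t) b.
Proof.
apply/is_derive1_caratheodory; exists (fun=> b).
by split; [move=> t; ring|exact: cvg_cst|].
Qed.

(** Maximum principle on the half cube for [w], the odd difference minus [k] times the barrier. On
    the outer faces the barrier wins, on the plane [coord i z = 0] the odd difference vanishes, and
    an interior maximum is impossible because the Laplacian of [w] is the positive number
    [2 * k]. *)
Lemma odd_part_bound D g (g1 : 'I_3 -> R3 R -> R)
    (g2 : 'I_3 -> 'I_3 -> R3 R -> R) x0 i (d M : R) :
  harmonic_jet D g g1 g2 -> 0 < d -> 0 < M ->
  (forall x, `|x - x0| <= d -> D x /\ `|g x| <= M) ->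
  forall z, `|z| <= d -> 0 <= coord i z ->
  g (x0 + z) - g (x0 + reflection i z) <= (2 * M / d ^+ 2) * barrier d i z.
Proof.
(* With this [k], a barrier value of [d ^+ 2] already gives [2 * M], the largest possible odd
   difference. *)
move=> gh d0 M0 Dg; set k := 2 * M / d ^+ 2.
have k0 : 0 < k by rewrite divr_gt0 ?exprn_gt0 ?mulr_gt0.
pose w z := g (x0 + z) - g (x0 + reflection i z) - k * barrier d i z.
pose C := [set z : R3 R | `|z| <= d] `&` [set z | 0 <= coord i z].
have CD z : C z -> D (x0 + z) /\ D (x0 + reflection i z).
  by move=> [/= zd _]; split; apply: (Dg _ _).1; rewrite addrC addKr ?norm_reflection.
have wC : {within C, continuous w}.
  apply: continuous_in_subspaceT => z; rewrite inE => /CD[/gh[gz1 _ _ _]].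
  move=> /gh[gz2 _ _ _].
  have cz : coord i z @[z --> z] --> coord i z by exact: continuous_coord.
  apply: cvgB; first apply: cvgB.
  - apply: (cvg_comp (fun z => x0 + z) g _ gz1).
    apply: cvgD; [exact: cvg_cst|exact: cvg_id].
  - apply: (cvg_comp (fun z => x0 + reflection i z) g _ gz2).
    apply: cvgD; [exact: cvg_cst|exact: continuous_reflection].
  - apply: cvgMl_tmp; apply: cvgD; first by apply: cvg_dot; exact: cvg_id.
    by apply: cvgM; [exact: cvgMl_tmp|apply: cvgB => //; exact: cvg_cst].
have C0 : C !=set0.
  by exists 0; split; rewrite /= ?coord0// normr0 ltW.
have cC : compact C.
  apply: compact_closedI; first exact: compact_max_ball.
  apply: (closed_comp _ (@closed_ge _ 0)) => z _; exact: continuous_coord.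
have [z0 /set_mem Cz0 wmax] := compact_EVT_max C0 cC wC.
suff wz0 : w z0 <= 0.
  move=> z zd z0i; have := wmax z (mem_set _); rewrite /C/= => /(_ (conj zd z0i)).
  by move=> /le_trans/(_ wz0); rewrite subr_le0.
have {}wmax z : C z -> w z <= w z0 by move=> /mem_set; exact: wmax.
have [z0d z0i] : `|z0| <= d /\ 0 <= coord i z0 by [].
have bM : d ^+ 2 <= barrier d i z0 -> w z0 <= 0.
  move=> bd; rewrite /w; have : 2 * M <= k * barrier d i z0.
    by rewrite -(@ler_pM2l _ k)// in bd; rewrite (le_trans _ bd)// divfK ?gt_eqF// exprn_gt0.
  have gM z : `|z| <= d -> `|g (x0 + z)| <= M.
    by move=> zd; apply: (Dg _ _).2; rewrite addrC addKr.
  have := gM z0 z0d; have := gM (reflection i z0); rewrite norm_reflection.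
  move=> /(_ z0d); rewrite !ler_norml; lra.
have ci_le : coord i z0 <= d by rewrite (le_trans (ler_norm _))// (le_trans (le_coord_norm _ _)).
have ge0 : 0 <= 4 * coord i z0 * (d - coord i z0).
  by rewrite mulr_ge0 ?mulr_ge0 ?subr_ge0.
have [z0d'|/negP] := boolP (`|z0| < d); last first.
  move=> /negP; rewrite -leNgt => dz0; apply: bM.
  (* Outer face: some coordinate has absolute value at least [d], so the term [dot z0 z0] of the
     barrier is at least [d ^+ 2]. *)
  have [j zj] := norm_coord z0.
  rewrite /barrier ler_wpDr// (le_trans _ (dot_ge_coord j _))//.
  rewrite -(real_normK (num_real (coord j z0))) -zj.
  by rewrite ler_sqr ?nnegrE ?normr_ge0 ?(ltW d0).
have [z0i'|] := ltP 0 (coord i z0); last first.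
  (* On the reflecting plane [z0] is its own reflection, and [w z0] is [- k * dot z0 z0]. *)
  move=> z0i0; have zi0 : coord i z0 = 0 by apply: le_anti; rewrite z0i z0i0.
  rewrite /w /reflection /barrier zi0 !mulr0 mul0r scale0r subr0 subrr sub0r addr0.
  by rewrite oppr_le0 mulr_ge0 ?dot_ge0// ltW.
exfalso.
(* Interior maximum: short segments through [z0] in every coordinate direction stay in the half
   cube, so each second derivative of [w] is nonpositive there. *)
pose del := Num.min (d - `|z0|) (coord i z0).
have del0 : 0 < del by rewrite lt_min subr_gt0 z0d'.
have Cline j s : `|s| < del -> C (z0 + s *: e_ j).
  rewrite lt_min => /andP[s1 s2]; split=> /=.
    rewrite (le_trans (ler_normD _ _))// normrZ norm_basis mulr1; lra.
  rewrite coordD coordZ coord_basis.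
  have : `|s * (i == j)%:R| <= `|s|.
    by case: eqP => _; rewrite ?mulr1// mulr0 normr0.
  rewrite ler_norml => /andP[]; lra.
have key j : g2 j j (x0 + z0) -
    g2 j j (x0 + reflection i z0) -
    k * (2 * (1 - 4 * (i == j)%:R)) <= 0.
  (* The reflection reverses [e_ i] and keeps the other directions. The sign appears once in the
     first derivative and twice, hence as 1, in the second. *)
  pose sg : R := if i == j then -1 else 1.
  have sg2 : sg * sg = 1 by rewrite /sg; case: ifP => _; ring.
  have [b hb] := barrier_line d i j z0 0.
  set c := 1 - 4 * (i == j)%:R.
  pose A t := g (x0 + z0 + t *: e_ j).
  pose A' t := g1 j (x0 + z0 + t *: e_ j).
  pose B t := g (x0 + reflection i z0 + t *: e_ j).
  pose B' t := g1 j (x0 + reflection i z0 + t *: e_ j).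
  have wE s : w (z0 + s *: e_ j) =
      A s - B (0 + sg * s) - k * (barrier d i z0 + b * s + c * s ^+ 2).
    by rewrite /w hb reflection_line /A /B !addrA add0r.
  apply: (@second_derivative_at_max _ (fun s => w (z0 + s *: e_ j))
    (fun s => A' s - sg * B' (0 + sg * s) - k * (b + 2 * c * s)) _ del) => //.
  - move=> s sdel; rewrite (_ : (fun s => _) = (fun s => A s - B (0 + sg * s) -
      k * (barrier d i z0 + b * s + c * s ^+ 2))); last exact/funext.
    have [DA DB] := CD _ (Cline j s sdel).
    rewrite /= in DA DB.
    have dA : is_derive s 1 A (A' s).
      apply: is_derive_line; have [_ /(_ j)[_ +] _ _] := gh _ DA.
      by rewrite addrA.
    have dB : is_derive s 1 (fun s => B (0 + sg * s)) (sg * B' (0 + sg * s)).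
      rewrite mulrC; apply: (@is_derive1_comp _ B); last exact: is_derive_affine.
      apply: is_derive_line; have [_ /(_ j)[_ +] _ _] := gh _ DB.
      by rewrite reflection_line addrA add0r.
    have dQ := is_derive_quadratic (barrier d i z0) b c s.
    exact: is_deriveB (is_deriveB dA dB) (is_deriveZ k dQ).
  - have [DA DB] := CD _ Cz0.
    have dA : is_derive (0 : R) 1 A' (g2 j j (x0 + z0)).
      apply: (@is_derive_line _ _ (g1 j)); have [_ _ /(_ j j)[_ +] _] := gh _ DA.
      by rewrite scale0r addr0.
    have dB : is_derive (0 : R) 1 (fun s => B' (0 + sg * s))
        (sg * g2 j j (x0 + reflection i z0)).
      rewrite mulrC; apply: (@is_derive1_comp _ B'); last exact: is_derive_affine.
      apply: (@is_derive_line _ _ (g1 j)); have [_ _ /(_ j j)[_ +] _] := gh _ DB.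
      by rewrite mulr0 addr0 scale0r addr0.
    have dQ := is_derive_affine b (2 * c) 0.
    have := is_deriveB (is_deriveB dA (is_deriveZ sg dB)) (is_deriveZ k dQ).
    by rewrite [sg *: _]mulrA sg2 mul1r; exact.
  - by move=> s sdel; rewrite scale0r addr0; apply/wmax/Cline.
(* Both Laplacians of [g] vanish, so this sum equals [2 * k], which is positive. *)
have : \sum_(j < 3) (g2 j j (x0 + z0) -
    g2 j j (x0 + reflection i z0) -
    k * (2 * (1 - 4 * (i == j)%:R))) <= 0 by exact: sumr_le0.
have [/gh[_ _ _ s1] /gh[_ _ _ s2]] := CD _ Cz0.
by rewrite (sum_line k s1 s2 (sum_barrier i)) mulrN opprK leNgt mulr_gt0.
Qed.

End gradient_bound.

(** * Closure properties of harmonic functions, and the gradient bound *)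

Section harmonic_functions.
Variable R : realType.
Implicit Types (D : set (R3 R)) (g : R3 R -> R) (x y z v : R3 R) (i j : 'I_3).
Local Notation e_ := (basis3 R).

Lemma near_eq_continuous g h x : {for x, continuous g} ->
  (\near x, g x = h x) -> {for x, continuous h}.
Proof.
move=> gx gh; have ghx := nbhs_singleton gh.
by rewrite /prop_for /continuous_at -ghx; apply: cvg_trans gx; exact: near_eq_cvg.
Qed.

(** The witnesses agree with the ['D_] derivatives on [D] only. Openness makes them agree near each
    point, which is what differentiating a second time requires. *)
Lemma harmonic_jet_on D g (g1 : 'I_3 -> R3 R -> R)
    (g2 : 'I_3 -> 'I_3 -> R3 R -> R) :
  open D -> harmonic_jet D g g1 g2 -> harmonic_on D g.
Proof.
move=> oD gD.
have nD x : D x -> \near x, D x by move=> Dx; exact: open_nbhs_nbhs.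
have D1 i x : D x -> 'D_(e_ i) g x = g1 i x by move=> /gD[_ /(_ i)[_ [_ ->]] _ _].
have nD1 i x : D x -> \near x, g1 i x = 'D_(e_ i) g x.
  by move=> /nD; apply: filterS => y /D1 ->.
have dD2 i j x : D x -> is_derive x (e_ j) ('D_(e_ i) g) (g2 i j x).
  move=> Dx; have [_ _ /(_ i j)[_] + _] := gD x Dx.
  by apply: near_eq_is_derive; exact: nD1.
have D2 i j x : D x -> 'D_(e_ j) ('D_(e_ i) g) x = g2 i j x.
  by move=> /(dD2 i j)[_ ->].
split; last first.
  move=> x Dx; rewrite /laplacian; have [_ _ _ g20] := gD x Dx; rewrite -[RHS]g20.
  by apply: eq_bigr => i _; exact: D2.
split; first by move=> x /gD[].
move=> i; split; first by move=> x /gD[_ /(_ i)[_ [gi _]] _ _].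
split.
  move=> x Dx; have [_ /(_ i)[gx _] _ _] := gD x Dx.
  exact: (near_eq_continuous gx (nD1 i x Dx)).
move=> j; split; first by move=> x /(dD2 i j)[].
split=> // x Dx; have [_ _ /(_ i j)[gx _] _] := gD x Dx.
apply: (near_eq_continuous gx).
by move: (nD _ Dx); apply: filterS => y /D2 ->.
Qed.

(** Every clause of [harmonic_on] is a condition at a single point on [g] and its ['D_] derivatives,
    so it can be read off from any [B] containing that point. *)
Lemma harmonic_on_local D g :
  (forall x, D x -> exists2 B : set (R3 R), B x & harmonic_on B g) -> harmonic_on D g.
Proof.
move=> gD; split; last by move=> x /gD[B Bx [_]]; exact.
split; first by move=> x /gD[B Bx [[+ _] _]]; exact.
move=> i; split; first by move=> x /gD[B Bx [[_ /(_ i)[+ _]] _]]; exact.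
split; first by move=> x /gD[B Bx [[_ /(_ i)[_ [+ _]]] _]]; exact.
move=> j; split.
  by move=> x /gD[B Bx [[_ /(_ i)[_ [_ /(_ j)[+ _]]]] _]]; exact.
by split=> // x /gD[B Bx [[_ /(_ i)[_ [_ /(_ j)[_ [+ _]]]]] _]]; exact.
Qed.

Lemma harmonic_onS D D' g : D `<=` D' -> harmonic_on D' g -> harmonic_on D g.
Proof. by move=> DD gD; apply: harmonic_on_local => x /DD D'x; exists D'. Qed.

Lemma eq_harmonic_on D g h : open D -> (forall x, D x -> g x = h x) ->
  harmonic_on D g -> harmonic_on D h.
Proof.
move=> oD gh /harmonic_onP[g1 [g2 gj]]; apply: (harmonic_jet_on (g1 := g1) (g2 := g2) oD).
move=> x Dx; have [g0c g1c g2c g20] := gj x Dx.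
have ngh : \near x, g x = h x.
  by apply: filterS gh _; exact: open_nbhs_nbhs.
split=> //; first exact: near_eq_continuous g0c ngh.
move=> i; have [gx dg] := g1c i; split=> //.
exact: (near_eq_is_derive ngh).
Qed.

Lemma harmonic_jetD D g h (g1 h1 : 'I_3 -> R3 R -> R)
    (g2 h2 : 'I_3 -> 'I_3 -> R3 R -> R) (a b : R) :
  harmonic_jet D g g1 g2 -> harmonic_jet D h h1 h2 ->
  harmonic_jet D (fun x => a * g x + b * h x) (fun i x => a * g1 i x + b * h1 i x)
    (fun i j x => a * g2 i j x + b * h2 i j x).
Proof.
move=> gD hD x Dx; have [g0c g1c g2c g20] := gD x Dx.
have [h0c h1c h2c h20] := hD x Dx; split.
- by apply: cvgD; exact: cvgMl_tmp.
- move=> i; have [gx dg] := g1c i; have [hx dh] := h1c i.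
  split; first by apply: cvgD; exact: cvgMl_tmp.
  exact: is_deriveD (is_deriveZ a dg) (is_deriveZ b dh).
- move=> i j; have [gx dg] := g2c i j; have [hx dh] := h2c i j.
  split; first by apply: cvgD; exact: cvgMl_tmp.
  exact: is_deriveD (is_deriveZ a dg) (is_deriveZ b dh).
- by rewrite big_split/= -!mulr_sumr g20 h20 !mulr0 addr0.
Qed.

Lemma harmonic_onD D g h (a b : R) : open D -> harmonic_on D g -> harmonic_on D h ->
  harmonic_on D (fun x => a * g x + b * h x).
Proof.
move=> oD /harmonic_onP[g1 [g2 gj]] /harmonic_onP[h1 [h2 hj]].
exact: harmonic_jet_on (harmonic_jetD a b gj hj).
Qed.

Lemma harmonic_on_cst D (c : R) : open D -> harmonic_on D (fun=> c).
Proof.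
move=> oD; apply: (@harmonic_jet_on D _ (fun _ _ => 0) (fun _ _ _ => 0) oD).
move=> x _; split; [exact: cvg_cst| | |by rewrite big1].
  by move=> i; split; [exact: cvg_cst|exact: is_derive_cst].
by move=> i j; split; [exact: cvg_cst|exact: is_derive_cst].
Qed.

Lemma harmonic_on_sum D (I : Type) (r : seq I) (h : I -> R3 R -> R) : open D ->
  (forall k, harmonic_on D (h k)) -> harmonic_on D (fun x => \sum_(k <- r) h k x).
Proof.
move=> oD hD; elim: r => [|i r IHr].
  by apply: eq_harmonic_on (harmonic_on_cst 0 oD) => // x _; rewrite big_nil.
apply: eq_harmonic_on (harmonic_onD 1 1 oD (hD i) IHr) => // x _.
by rewrite big_cons !mul1r.
Qed.

Lemma is_derive_translate g x v w (d : R) :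
  is_derive (x + v) w g d -> is_derive x w (fun y => g (y + v)) d.
Proof.
move=> /is_deriveP gd; apply/is_deriveP; apply: cvg_trans gd.
by apply: near_eq_cvg; near=> h; rewrite addrA.
Unshelve. all: by end_near. Qed.

Lemma continuous_translate g x v :
  {for x + v, continuous g} -> {for x, continuous (fun y => g (y + v))}.
Proof.
move=> gx; apply: (cvg_comp (fun y => y + v) g _ gx).
by apply: cvgD; [exact: cvg_id|exact: cvg_cst].
Qed.

Lemma harmonic_jet_translate D g (g1 : 'I_3 -> R3 R -> R)
    (g2 : 'I_3 -> 'I_3 -> R3 R -> R) v : harmonic_jet D g g1 g2 ->
  harmonic_jet [set x | D (x + v)] (fun x => g (x + v)) (fun i x => g1 i (x + v))
    (fun i j x => g2 i j (x + v)).
Proof.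
move=> gD x /gD[g0c g1c g2c g20]; split => //.
- exact: (@continuous_translate g).
- move=> i; have [gx dg] := g1c i.
  by split; [exact: (@continuous_translate (g1 i))|exact: is_derive_translate].
- move=> i j; have [gx dg] := g2c i j.
  by split; [exact: (@continuous_translate (g2 i j))|exact: is_derive_translate].
Qed.

(** The odd difference along [e_ i] has derivative [2 * g1 i x0] at 0, while [odd_part_bound] at
    [t *: e_ i] bounds it by [8 * M / d * t]. *)
Let gradient_upper_bound D g (g1 : 'I_3 -> R3 R -> R)
    (g2 : 'I_3 -> 'I_3 -> R3 R -> R) x0 i (d M : R) :
  harmonic_jet D g g1 g2 -> 0 < d -> 0 < M ->
  (forall x, `|x - x0| <= d -> D x /\ `|g x| <= M) ->
  g1 i x0 <= 4 * M / d.
Proof.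
move=> gh d0 M0 Dg.
have Dx0 : D x0 by apply: (Dg x0 _).1; rewrite subrr normr0 ltW.
have [_ /(_ i)[_ dg] _ _] := gh _ Dx0.
set l := g1 i x0 in dg *.
rewrite leNgt; apply/negP => Ml.
pose h (t : R) := g (x0 + t *: e_ i) - g (x0 + (0 + (- 1) * t) *: e_ i).
have dh : is_derive (0 : R) 1 h (l - l * (-1)).
  have d1 : is_derive (0 : R) 1 (fun t => g (x0 + t *: e_ i)) l.
    by apply: is_derive_line; rewrite scale0r addr0.
  apply: is_deriveB => //.
  apply: (@is_derive1_comp _ (fun t => g (x0 + t *: e_ i)) (fun t => 0 + (- 1) * t)).
    by rewrite mulr0 addr0.
  exact: is_derive_affine.
have {dh} /is_deriveP/cvg_dnbhs_at_right : is_derive (0 : R) 1 h (2 * l).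
  by apply: is_derive_eq dh _; ring.
have Ml2 : 8 * M / d < 2 * l by move: Ml; lra.
move=> /cvgr_gt/(_ _ Ml2) hgt.
near (0 : R)^'+ => t.
have t0 : 0 < t by near: t; exact: nbhs_right_gt.
have td : t < d by near: t; exact: nbhs_right_lt.
have : 8 * M / d < t^-1 *: (h (t *: 1 + 0) - h 0) by near: t.
rewrite addr0 [t *: 1]mulr1 {2}/h mulr0 addr0 scale0r subrr subr0.
rewrite [_ *: _]mulrC ltr_pdivlMr// ltNge => /negP; apply.
have te : `|t *: e_ i| <= d by rewrite normrZ norm_basis mulr1 gtr0_norm// ltW.
have ct : coord i (t *: e_ i) = t by rewrite coordZ coord_basis eqxx mulr1.
have rt : reflection i (t *: e_ i) = (0 + (- 1) * t) *: e_ i.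
  by rewrite /reflection ct -scalerBl; congr (_ *: _); ring.
have := @odd_part_bound _ _ _ _ _ _ i _ _ gh d0 M0 Dg _ te; rewrite ct rt => /(_ (ltW t0)).
move/le_trans; apply.
have -> : dot (t *: e_ i) (t *: e_ i) = t ^+ 2.
  have := dot_line i 0 t; rewrite add0r => ->.
  by rewrite /coord /dot/= !mul0r !addr0 mulr0 mul0r !add0r.
have -> : 8 * M / d * t = 2 * M / d ^+ 2 * (4 * t * d) by field; rewrite gt_eqF.
rewrite ler_pM2l; last by rewrite divr_gt0 ?exprn_gt0 ?mulr_gt0.
(* The barrier at [t *: e_ i] is [4 * t * d - 3 * t ^+ 2]. *)
by have := sqr_ge0 t; nra.
Unshelve. all: by end_near. Qed.

Lemma gradient_bound D g (g1 : 'I_3 -> R3 R -> R)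
    (g2 : 'I_3 -> 'I_3 -> R3 R -> R) x0 i (d M : R) :
  harmonic_jet D g g1 g2 -> 0 < d -> 0 < M ->
  (forall x, `|x - x0| <= d -> D x /\ `|g x| <= M) ->
  `|g1 i x0| <= 4 * M / d.
Proof.
move=> gh d0 M0 Dg; rewrite ler_norml; apply/andP; split; last first.
  exact: gradient_upper_bound gh d0 M0 Dg.
(* The lower bound is the upper bound for [- g], written as [-1 * g + 0 * g]. *)
have := @gradient_upper_bound D _ _ _ x0 i d M (harmonic_jetD (-1) 0 gh gh) d0 M0.
rewrite mul0r addr0 mulN1r => H; rewrite lerNl; apply: H => x /Dg[Dx gx].
by split=> //; rewrite mul0r addr0 mulN1r normrN.
Qed.

End harmonic_functions.

(** * Uniform limits of harmonic functions *)

Lemma le_of_vanishing_excess (R : realType) (a b C : R) :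
  (forall n, a <= b + C / n.+1%:R) -> a <= b.
Proof.
move=> abC; apply/ler_addgt0Pr => e e0.
have [C0|C0] := leP C 0.
  rewrite (le_trans (abC 0))// lerD2l (le_trans _ (ltW e0))//.
  by rewrite pmulr_lle0// invr_gt0.
have : \forall n \near \oo, harmonic n < e / C :> R.
  apply: (cvgr_lt (0 : R)); [exact: cvg_harmonic|exact: divr_gt0].
case=> N _ /(_ N (leqnn N)); rewrite /harmonic/= ltr_pdivlMr// => NC.
by rewrite (le_trans (abC N))// lerD2l mulrC ltW.
Qed.

(** Each [a m + C / m.+1%:R] bounds all [a n - C / n.+1%:R] from above, so the supremum of these
    lower ends is a limit that comes with the explicit rate. *)
Lemma cauchy_rate_limit (R : realType) (a : nat -> R) (C : R) :
  (forall n m, `|a n - a m| <= C / n.+1%:R + C / m.+1%:R) ->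
  exists l, forall n, `|a n - l| <= C / n.+1%:R.
Proof.
move=> aC; pose A := range (fun n => a n - C / n.+1%:R).
have A_ub m : ubound A (a m + C / m.+1%:R).
  by move=> _ [n _ <-]; have := aC n m; rewrite ler_norml;
    move: (C / n.+1%:R) (C / m.+1%:R) => c c'; lra.
exists (sup A) => n; rewrite ler_norml; apply/andP; split.
  have : sup A <= a n + C / n.+1%:R.
    by apply: ge_sup; [exists (a 0 - C / 1%:R), 0%N|exact: A_ub].
  by move: (C / n.+1%:R) => c; lra.
have : a n - C / n.+1%:R <= sup A.
  apply: ub_le_sup; last by exists n.
  by exists (a 0 + C / 1%:R); exact: A_ub.
by move: (C / n.+1%:R) => c; lra.
Qed.

Lemma mean_value_bound (R : realType) (h h' : R -> R) (e s : R) :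
  (forall t : R, `|t| <= `|s| -> is_derive t 1 h (h' t) /\ `|h' t| <= e) ->
  `|h s - h 0| <= e * `|s|.
Proof.
have pos (f f' : R -> R) (u : R) : 0 < u ->
    (forall t : R, `|t| <= u -> is_derive t 1 f (f' t) /\ `|f' t| <= e) ->
    `|f u - f 0| <= e * u.
  move=> u0 ff'; have tu t : 0 <= t <= u -> `|t| <= u.
    by move=> /andP[t0 tu]; rewrite ger0_norm.
  have cf : {within `[0, u], continuous f}.
    apply: continuous_in_subspaceT => t; rewrite inE/= in_itv/= => /tu/ff'[+ _].
    exact: is_derive_continuous.
  have df (t : R) : 0 < t < u -> is_derive t 1 f (f' t).
    by move=> /andP[t0 ut]; apply: (ff' t _).1; rewrite tu// !ltW.
  have [t /andP[t0 ut] ->] := MVT_is_derive u0 df cf.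
  rewrite normrM (gtr0_norm u0) ler_pM2r//.
  by apply: (ff' t _).2; rewrite tu// !ltW.
move=> hh'; have [s0|s0|s0] := ltgtP s 0.
- have := pos (fun t => h (0 + -1 * t)) (fun t => h' (0 + -1 * t) * -1) (- s).
  rewrite oppr_gt0 mulr0 addr0 add0r mulN1r opprK (ltr0_norm s0).
  apply=> // t ts; have := hh' (0 + -1 * t); rewrite add0r mulN1r normrN (ltr0_norm s0).
  move=> /(_ ts)[dh he]; split; last by rewrite mulrN1 normrN.
  apply: (@is_derive1_comp _ h (fun t => 0 + -1 * t)).
    by rewrite add0r mulN1r.
  exact: is_derive_affine.
- rewrite (gtr0_norm s0); apply: (pos h h' s s0) => t ts; apply: hh'.
  by rewrite (gtr0_norm s0).
- by rewrite s0 subrr normr0 mulr0.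
Qed.

Section uniform_limits.
Variables (R : realType) (V : normedModType R).
Implicit Types (D : set V) (x v : V).

Lemma increment_bound (g g' : V -> R) x v (e s : R) :
  (forall t : R, `|t| <= `|s| ->
    is_derive (x + t *: v) v g (g' (x + t *: v)) /\ `|g' (x + t *: v)| <= e) ->
  `|g (x + s *: v) - g x| <= e * `|s|.
Proof.
move=> gg'; rewrite -{2}[x]addr0 -(scale0r v).
apply: (@mean_value_bound _ (fun t => g (x + t *: v)) (fun t => g' (x + t *: v))).
by move=> t /gg'[dg ge]; split=> //; exact: is_derive_line.
Qed.

Lemma continuous_uniform_limit D (gn : nat -> V -> R) g (C : R) : open D ->
  (forall n x, D x -> `|gn n x - g x| <= C / n.+1%:R) ->
  (forall n x, D x -> {for x, continuous (gn n)}) ->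
  forall x, D x -> {for x, continuous g}.
Proof.
move=> oD gng gnc x Dx; apply/cvgrPdist_le => e e0.
have [n nC] : exists n, C / n.+1%:R <= e / 3.
  apply: contrapT => /forallNP nC.
  suff : e / 3 <= 0 by lra.
  apply: (@le_of_vanishing_excess _ _ _ C) => n.
  by rewrite add0r; have /negP := nC n; rewrite -ltNge => /ltW.
have e30 : 0 < e / 3 by lra.
have /cvgrPdist_le/(_ _ e30) := gnc n x Dx.
have : \near x, D x by exact: open_nbhs_nbhs.
apply: filterS2 => y Dy xy.
have := gng n x Dx; have := gng n y Dy; move: xy nC.
by rewrite !ler_norml; move: (C / n.+1%:R) => c; lra.
Qed.

(** For fixed [h], the mean value inequality is applied to [gn n] minus its expected linear part
    [k x * t]; the bound survives [n] going to infinity because the error terms vanish at an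
    explicit rate. *)
Lemma is_derive_uniform_limit D v (gn gn' : nat -> V -> R) (g k : V -> R) (C : R) :
  open D ->
  (forall n x, D x -> is_derive x v (gn n) (gn' n x)) ->
  (forall n x, D x -> `|gn n x - g x| <= C / n.+1%:R) ->
  (forall n x, D x -> `|gn' n x - k x| <= C / n.+1%:R) ->
  forall x, D x -> {for x, continuous k} -> is_derive x v g (k x).
Proof.
move=> oD dgn gng gnk x Dx kx; apply/is_deriveP/cvgrPdist_le => e e0.
have /cvgrPdist_le/(_ _ e0) kxe := kx.
have nD : \near x, D x by exact: open_nbhs_nbhs.
have cl : x + t *: v @[t --> (0 : R)] --> x.
  rewrite -[X in _ --> X]addr0 -(scale0r v); apply: cvgD; first exact: cvg_cst.
  by apply: cvgZr_tmp; exact: cvg_id.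
have /cl : \near x, D x by [].
have /cl := kxe.
move=> /nbhs_ballP[d1 /= d10 d1P] /nbhs_ballP[d2 /= d20 d2P].
near=> h.
have hd1 : `|h| < d1 by near: h; exact: dnbhs0_lt.
have hd2 : `|h| < d2 by near: h; exact: dnbhs0_lt.
have h0 : h != 0 by near: h; exact: nbhs_dnbhs_neq.
have xh t : `|t| <= `|h| -> D (x + t *: v) /\ `|k x - k (x + t *: v)| <= e.
  move=> th; split; [apply: d2P|apply: d1P];
  by rewrite /ball/= sub0r normrN (le_lt_trans th).
have [Dxh _] := xh h (lexx _).
have gh : `|g (x + h *: v) - g x - h * k x| <= e * `|h|.
  (* The part with [|h|] comes from replacing [gn' n] by [k] along the segment, the 2 from replacing
     [gn n] by [g] at its two ends. *)
  apply: (@le_of_vanishing_excess _ _ _ (C * (`|h| + 2))) => n.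
  have dG (t : R) : `|t| <= `|h| ->
      is_derive t 1 (fun t => gn n (x + t *: v) - (0 + k x * t))
        (gn' n (x + t *: v) - k x) /\
      `|gn' n (x + t *: v) - k x| <= C / n.+1%:R + e.
    move=> th; have [Dt kt] := xh t th; split.
      apply: is_deriveB; last exact: is_derive_affine.
      by apply: is_derive_line; exact: dgn.
    have := gnk n _ Dt; have := gnk n x Dx; move: kt.
    by rewrite !ler_norml; move: (C / n.+1%:R) => c; lra.
  have := mean_value_bound dG; rewrite scale0r addr0 mulr0 !add0r subr0 [k x * h]mulrC.
  have := gng n _ Dxh; have := gng n x Dx; have := normr_ge0 h.
  rewrite [C * _ / _]mulrAC; move: (C / n.+1%:R) => c; rewrite !ler_norml; nra.
rewrite -[_ *: _]/(h^-1 * _) [h *: v + x]addrC distrC.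
have -> : h^-1 * (g (x + h *: v) - g x) - k x =
    (g (x + h *: v) - g x - h * k x) / h by field.
by rewrite normrM normfV ler_pdivrMr ?normr_gt0.
Unshelve. all: by end_near. Qed.

End uniform_limits.

Section harmonic_limits.
Variable R : realType.
Implicit Types (D : set (R3 R)) (g : R3 R -> R) (x y z v : R3 R) (i j : 'I_3).
Local Notation e_ := (basis3 R).

Lemma harmonic_jetS D D' g (g1 : 'I_3 -> R3 R -> R) (g2 : 'I_3 -> 'I_3 -> R3 R -> R) :
  D `<=` D' -> harmonic_jet D' g g1 g2 -> harmonic_jet D g g1 g2.
Proof. by move=> DD' gD x /DD'/gD. Qed.

(* The first derivatives are not yet known to be harmonic, hence the gradient
   bound is applied to difference quotients of [g] instead. *)
Lemma hessian_bound D g (g1 : 'I_3 -> R3 R -> R) (g2 : 'I_3 -> 'I_3 -> R3 R -> R)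
    x0 i j (d M : R) :
  harmonic_jet D g g1 g2 -> 0 < d -> 0 < M ->
  (forall x, `|x - x0| <= 2 * d -> D x /\ `|g x| <= M) ->
  `|g2 i j x0| <= 32 * M / d ^+ 2.
Proof.
move=> gD d0 M0 Dg.
have d20 : 0 < d / 2 by lra.
have K0 : 0 < 4 * M / d by rewrite divr_gt0// mulr_gt0.
have g1d y : `|y - x0| <= d -> `|g1 j y| <= 4 * M / d.
  move=> yd; apply: (gradient_bound j gD d0 M0) => x xy; apply: Dg.
  rewrite -(subrK y x) -addrA (le_trans (ler_normD _ _))//; lra.
(* For [x] within [d / 2] of [x0] and [|h| <= d / 2], the segment from [x] to [x + h *: e_ j] stays
   within [d] of [x0]. There [g1 j] is at most [4 * M / d], so the quotient obeys the same bound,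
   and [gradient_bound] on radius [d / 2] multiplies it by [8 / d]. *)
have quotient_bound h : h != 0 -> `|h| <= d / 2 ->
    `|h^-1 * (g1 i (x0 + h *: e_ j) - g1 i x0)| <= 32 * M / d ^+ 2.
  move=> h0 hd; pose v : R3 R := h *: e_ j; rewrite -/v.
  pose D' := [set x | D (x + v)] `&` D.
  have := harmonic_jetD h^-1 (- h^-1)
    (harmonic_jetS (@subIsetl _ _ _ : D' `<=` _) (@harmonic_jet_translate _ _ _ _ _ v gD))
    (harmonic_jetS (@subIsetr _ _ _ : D' `<=` _) gD).
  move=> /gradient_bound - /(_ x0 i _ _ d20 K0).
  have -> : h^-1 * (g1 i (x0 + v) - g1 i x0) =
      h^-1 * g1 i (x0 + v) + - h^-1 * g1 i x0 by ring.
  have -> : 4 * (4 * M / d) / (d / 2) = 32 * M / d ^+ 2.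
    by field; rewrite gt_eqF.
  apply=> x xd.
  have xt t : `|t| <= `|h| -> `|x + t *: e_ j - x0| <= d.
    move=> th; rewrite addrAC (le_trans (ler_normD _ _))// normrZ norm_basis mulr1.
    lra.
  have dd z : `|z - x0| <= d -> D z by move=> zd; apply: (Dg z _).1; lra.
  split.
    split; first exact/dd/xt.
    by apply: dd; lra.
  rewrite mulNr -mulrBr normrM normfV mulrC ler_pdivrMr ?normr_gt0//.
  apply: (increment_bound (g' := g1 j)) => t th; split; last exact/g1d/xt.
  by have [_ /(_ j)[]] := gD _ (dd _ (xt t th)).
have Dx0 : D x0 by apply: (Dg x0 _).1; rewrite subrr normr0; lra.
have [_ _ /(_ i j)[_ /is_deriveP dg] _] := gD _ Dx0.
rewrite leNgt; apply/negP => Kg.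
(* Passage to the limit: were [|g2 i j x0|] larger than the bound, so would be the quotients for
   small [h]. *)
move/cvgrPdist_lt : dg => /(_ (`|g2 i j x0| - 32 * M / d ^+ 2)).
rewrite subr_gt0 => /(_ Kg) dg.
near (0 : R)^' => h.
have h0 : h != 0 by near: h; exact: nbhs_dnbhs_neq.
have hd : `|h| < d / 2 by near: h; exact: dnbhs0_lt.
have := quotient_bound h h0 (ltW hd); rewrite leNgt => /negP; apply.
have : `|g2 i j x0 - h^-1 *: (g1 i (h *: e_ j + x0) - g1 i x0)| <
  `|g2 i j x0| - 32 * M / d ^+ 2 by near: h.
rewrite -[_ *: (_ - _)]/(_ * _) [h *: e_ j + x0]addrC.
set q := h^-1 * _; have : `|g2 i j x0| <= `|g2 i j x0 - q| + `|q|.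
  by rewrite -{1}(subrK q (g2 i j x0)) ler_normD.
lra.
Unshelve. all: by end_near. Qed.

Lemma open_max_ball x0 (r : R) : open [set x : R3 R | `|x - x0| < r].
Proof.
rewrite openE => x /= xr; apply/nbhs_ballP.
exists (r - `|x - x0|) => /=; first by rewrite subr_gt0.
move=> y; rewrite prod_norm_ball /ball_/= distrC => yx.
by rewrite -(subrK x y) -addrA (le_lt_trans (ler_normD _ _))// -ltrBrDr.
Qed.

(** Differences of two approximants are harmonic and uniformly small, so the gradient and Hessian
    bounds make their derivatives Cauchy with explicit rates on the half cube. The limits of the
    derivatives form a jet of [g]. *)
Lemma harmonic_on_uniform_limit x0 (r : R) g : 0 < r ->
  (forall e : R, 0 < e -> exists h, harmonic_on [set x | `|x - x0| < r] h /\
     forall x, `|x - x0| < r -> `|h x - g x| <= e) ->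
  harmonic_on [set x | `|x - x0| < r / 2] g.
Proof.
move=> r0 gh; pose D := [set x | `|x - x0| < r]; rewrite -/D in gh.
have /choice[gn] : forall n, exists J : (R3 R -> R) * ('I_3 -> R3 R -> R) *
      ('I_3 -> 'I_3 -> R3 R -> R),
    harmonic_jet D J.1.1 J.1.2 J.2 /\ forall x, D x -> `|J.1.1 x - g x| <= 1 / n.+1%:R.
  move=> n; have [|h [/harmonic_onP[h1 [h2 hj]] hg]] := gh (1 / n.+1%:R).
    by rewrite div1r invr_gt0.
  by exists (h, h1, h2).
move=> /all_and2[gj gng].
pose D2 := [set x | `|x - x0| < r / 2]; rewrite -/D2; have D2D : D2 `<=` D 
  by move=> x /lt_trans; apply; lra.
have oD2 : open D2 by exact: open_max_ball.
(* From a point of the half cube, the radius [2 * d] used by [hessian_bound] reaches at most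
   [r / 2 + 2 * r / 5], still less than [r]. *)
pose d := r / 5; have d0 : 0 < d by rewrite /d; lra.
have ball_D x y : D2 x -> `|y - x| <= 2 * d -> D y.
  move=> /= x0x yx; rewrite /D/= -(subrK x y) -addrA.
  apply: (le_lt_trans (ler_normD _ _)); apply: (lt_le_trans (ler_ltD yx x0x)).
  by rewrite /d; lra.
have gnm n m x : D x ->
    `|1 * (gn n).1.1 x + -1 * (gn m).1.1 x| <= 1 / n.+1%:R + 1 / m.+1%:R.
  move=> Dx; have := gng n x Dx; have := gng m x Dx; rewrite !ler_norml.
  by move: (1 / n.+1%:R) (1 / m.+1%:R) => c c'; lra.
have pos n m : 0 < 1 / n.+1%:R + 1 / m.+1%:R :> R.
  by rewrite addr_gt0// div1r invr_gt0.
have grad n m i x : D2 x -> `|(gn n).1.2 i x - (gn m).1.2 i x| <=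
    (4 / d) / n.+1%:R + (4 / d) / m.+1%:R.
  move=> D2x; have := harmonic_jetD 1 (-1) (gj n) (gj m).
  move=> /gradient_bound - /(_ x i d _ d0 (pos n m)).
  have -> : 4 * (1 / n.+1%:R + 1 / m.+1%:R) / d =
      (4 / d) / n.+1%:R + (4 / d) / m.+1%:R :> R.
    by rewrite !div1r; move: n.+1%:R^-1 m.+1%:R^-1 => c c'; ring.
  move=> H; rewrite -[(gn n).1.2 i x]mul1r -[- (gn m).1.2 i x]mulN1r.
  apply: H => y yx; have Dy : D y by apply: ball_D D2x _; lra.
  by split => //; exact: gnm.
have hess n m i j x : D2 x -> `|(gn n).2 i j x - (gn m).2 i j x| <=
    (32 / d ^+ 2) / n.+1%:R + (32 / d ^+ 2) / m.+1%:R.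
  move=> D2x; have := harmonic_jetD 1 (-1) (gj n) (gj m).
  move=> /hessian_bound - /(_ x i j d _ d0 (pos n m)).
  have -> : 32 * (1 / n.+1%:R + 1 / m.+1%:R) / d ^+ 2 =
      (32 / d ^+ 2) / n.+1%:R + (32 / d ^+ 2) / m.+1%:R :> R.
    by rewrite !div1r; move: n.+1%:R^-1 m.+1%:R^-1 (d ^+ 2)^-1 => c c' c''; ring.
  move=> H; rewrite -[(gn n).2 i j x]mul1r -[- (gn m).2 i j x]mulN1r.
  apply: H => y yx; have Dy : D y by exact: ball_D D2x yx.
  by split => //; exact: gnm.
(* Limits are chosen pointwise, with value 0 allowed outside [D2], where nothing is claimed. *)
have /choice[k1 k1P] : forall p : 'I_3 * R3 R, exists l, D2 p.2 ->
    forall n, `|(gn n).1.2 p.1 p.2 - l| <= (4 / d) / n.+1%:R.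
  move=> [i x]; have [D2x|] := pselect (D2 x); last by exists 0.
  have [|l lP] := @cauchy_rate_limit _ (fun n => (gn n).1.2 i x) (4 / d).
    by move=> n m; exact: grad.
  by exists l.
have /choice[k2 k2P] : forall p : 'I_3 * 'I_3 * R3 R, exists l, D2 p.2 ->
    forall n, `|(gn n).2 p.1.1 p.1.2 p.2 - l| <= (32 / d ^+ 2) / n.+1%:R.
  move=> [[i j] x]; have [D2x|] := pselect (D2 x); last by exists 0.
  have [|l lP] := @cauchy_rate_limit _ (fun n => (gn n).2 i j x) (32 / d ^+ 2).
    by move=> n m; exact: hess.
  by exists l.
have c0 x : D2 x -> {for x, continuous g}.
  apply: (@continuous_uniform_limit _ _ D2 (fun n => (gn n).1.1) _ 1 oD2).
    by move=> n y /D2D; exact: gng.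
  by move=> n y /D2D Dy; have [] := gj n y Dy.
have c1 i x : D2 x -> {for x, continuous (fun x => k1 (i, x))}.
  apply: (@continuous_uniform_limit _ _ D2 (fun n => (gn n).1.2 i) _ (4 / d) oD2).
    by move=> n y /(k1P (i, y)).
  by move=> n y /D2D Dy; have [_ /(_ i)[]] := gj n y Dy.
have c2 i j x : D2 x -> {for x, continuous (fun x => k2 (i, j, x))}.
  apply: (@continuous_uniform_limit _ _ D2 (fun n => (gn n).2 i j) _ (32 / d ^+ 2) oD2).
    by move=> n y /(k2P (i, j, y)).
  by move=> n y /D2D Dy; have [_ _ /(_ i j)[]] := gj n y Dy.
apply: (@harmonic_jet_on _ D2 g (fun i x => k1 (i, x)) (fun i j x => k2 (i, j, x)) oD2).
move=> x D2x; split; first exact: c0.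
- move=> i; split; first exact: c1.
  apply: (@is_derive_uniform_limit _ _ D2 (e_ i) (fun n => (gn n).1.1)
    (fun n => (gn n).1.2 i) g (fun x => k1 (i, x)) (Num.max 1 (4 / d)) oD2) => //.
  + by move=> n y /D2D Dy; have [_ /(_ i)[]] := gj n y Dy.
  + move=> n y /D2D Dy; rewrite (le_trans (gng n y Dy))// ler_pM2r ?invr_gt0//.
    by rewrite le_max lexx.
  + move=> n y /(k1P (i, y))/(_ n)/le_trans; apply; rewrite ler_pM2r ?invr_gt0//.
    by rewrite le_max lexx orbT.
  + exact: c1.
- move=> i j; split; first exact: c2.
  apply: (@is_derive_uniform_limit _ _ D2 (e_ j) (fun n => (gn n).1.2 i)
    (fun n => (gn n).2 i j) (fun x => k1 (i, x)) (fun x => k2 (i, j, x))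
    (Num.max (4 / d) (32 / d ^+ 2)) oD2) => //.
  + by move=> n y /D2D Dy; have [_ _ /(_ i j)[]] := gj n y Dy.
  + move=> n y /(k1P (i, y))/(_ n)/le_trans; apply; rewrite ler_pM2r ?invr_gt0//.
    by rewrite le_max lexx.
  + move=> n y /(k2P (i, j, y))/(_ n)/le_trans; apply; rewrite ler_pM2r ?invr_gt0//.
    by rewrite le_max lexx orbT.
  + exact: c2.
(* The Laplacian of each approximant is 0, so that of the limit is bounded by three Hessian errors
   for every [n]. *)
- apply/eqP; rewrite -normr_eq0 -normr_le0.
  apply: (@le_of_vanishing_excess _ _ _ (3 * (32 / d ^+ 2))) => n.
  have [_ _ _ s0] := gj n x (D2D _ D2x).
  have -> : \sum_(i < 3) k2 (i, i, x) =
      - \sum_(i < 3) ((gn n).2 i i x - k2 (i, i, x)).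
    by rewrite sumrB s0 sub0r opprK.
  rewrite add0r normr_id normrN.
  rewrite (le_trans (ler_norm_sum _ _ _))//.
  rewrite (le_trans (ler_sum _ (fun i _ => k2P (i, i, x) D2x n)))//.
  rewrite !big_ord_recl big_ord0 -[3 * _ / _]mulrA.
  by move: (32 / d ^+ 2 / n.+1%:R) => c; lra.
Qed.

(** The form in which the closure is applied, to the kernels of H_R and then to the integral over
    each patch; the radius must not depend on the accuracy. *)
Lemma harmonic_on_approximable D g :
  (forall x0, D x0 -> exists2 r : R, 0 < r & forall e : R, 0 < e ->
    exists h, harmonic_on [set x | `|x - x0| < r] h /\
      forall x, `|x - x0| < r -> `|h x - g x| <= e) ->
  harmonic_on D g.
Proof.
move=> gD; apply: harmonic_on_local => x0 /gD[r r0 rP].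
exists [set x | `|x - x0| < r / 2]; last exact: harmonic_on_uniform_limit.
by rewrite /= subrr normr0 divr_gt0.
Qed.

End harmonic_limits.

(** * Integrals depending harmonically on a parameter *)

Section plane_measurability.
Variable R : realType.
Local Notation T2 := (measurableTypeR R * measurableTypeR R)%type.

(** The sigma-algebra on the plane is generated by rectangles, so an open set is exhibited as a
    countable union of boxes with rational corners. *)
Lemma open_measurable_plane (A : set (R2 R)) : open A -> measurable (A : set T2).
Proof.
move=> oA.
pose box (q : rat * rat * (rat * rat)) : set (R2 R) :=
  `]ratr q.1.1, ratr q.1.2[%classic `*` `]ratr q.2.1, ratr q.2.2[%classic.
have -> : A = \bigcup_(q : rat * rat * (rat * rat))
    (if `[< box q `<=` A >] then box q else set0).
  apply/seteqP; split=> [p Ap|p [q _]]; last by case: asboolP => // + qp; exact.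
  have /nbhs_ballP[e /= e0 eA] : nbhs p A by exact: open_nbhs_nbhs.
  have [a1 ha1] : exists q : rat, ratr q \in `]p.1 - e, p.1[.
    by apply: rat_in_itvoo; lra.
  have [b1 hb1] : exists q : rat, ratr q \in `]p.1, p.1 + e[.
    by apply: rat_in_itvoo; lra.
  have [a2 ha2] : exists q : rat, ratr q \in `]p.2 - e, p.2[.
    by apply: rat_in_itvoo; lra.
  have [b2 hb2] : exists q : rat, ratr q \in `]p.2, p.2 + e[.
    by apply: rat_in_itvoo; lra.
  rewrite !in_itv/= in ha1 hb1 ha2 hb2.
  exists (a1, b1, (a2, b2)) => //; case: asboolP => [_|[]].
    by split; rewrite /= in_itv/=; lra.
  move=> p' [] /=; rewrite !in_itv/= => p1 p2; apply: eA; split=> /=;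
  by rewrite /ball/= ltr_norml; lra.
apply: countable_bigcupT_measurable => //.
move=> q; case: asboolP => _ //; apply: measurableX; exact: measurable_itv.
Qed.

Lemma compact_measurable_plane (A : set (R2 R)) : compact A -> measurable (A : set T2).
Proof.
move=> cA; rewrite -[A]setCK; apply: measurableC; apply: open_measurable_plane.
apply: closed_openC; apply: compact_closed => //; exact: norm_hausdorff.
Qed.

Lemma continuous_measurable_plane (A : set (R2 R)) (g : R2 R -> R) : open A ->
  (forall p, A p -> {for p, continuous g}) ->
  measurable_fun (A : set T2) (g : T2 -> R).
Proof.
move=> oA gc; apply: (measurability _ (RGenOpens.measurableE R)).
move=> _ [_ [a [b ->] <-]]; apply: open_measurable_plane.
rewrite openE => p [Ap gp]; apply: filterI; first exact: open_nbhs_nbhs.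
by apply: (gc p Ap); apply: open_nbhs_nbhs; split => //; exact: interval_open.
Qed.

Lemma open_osquare : open (@osquare R).
Proof.
rewrite openE => -[p1 p2] [/= h1 h2].
exists (`]0, 1[%classic, `]0, 1[%classic).
  by split; apply: open_nbhs_nbhs; split; rewrite /= ?in_itv//; exact: interval_open.
by move=> q [/=]; rewrite !in_itv.
Qed.

Lemma measurable_osquare : measurable (@osquare R : set T2).
Proof. by apply: open_measurable_plane; exact: open_osquare. Qed.

Lemma leb2_osquare : (leb2 R (@osquare R) < +oo)%E.
Proof.
have -> : @osquare R = `]0, 1[%classic `*` `]0, 1[%classic.
  by apply/seteqP; split=> p /=; rewrite !in_itv.
have mE := @product_measure1E _ _ _ _ R (@lebesgue_measure R) (@lebesgue_measure R)
  `]0, 1[%classic `]0, 1[%classic (measurable_itv _) (measurable_itv _).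
rewrite -[leb2 R _]/((@lebesgue_measure R \x @lebesgue_measure R)%E _) mE /=.
by rewrite !lebesgue_measure_itv/= lte01 sube0 mule1 ltry.
Qed.

Lemma compact_csquare : compact (@csquare R).
Proof.
have -> : @csquare R = `[0, 1]%classic `*` `[0, 1]%classic.
  by apply/seteqP; split=> p /=; rewrite !in_itv.
by apply: compact_setX; exact: segment_compact.
Qed.

(** A compact exhaustion of the open square that avoids its edges. The shift by 2 makes the margin
    at most 1/2, so that no member is empty. *)
Definition inner_square (n : nat) : set (R2 R) :=
  `[n.+2%:R^-1, 1 - n.+2%:R^-1]%classic `*` `[n.+2%:R^-1, 1 - n.+2%:R^-1]%classic.

Lemma compact_inner_square n : compact (inner_square n).
Proof. by apply: compact_setX; exact: segment_compact. Qed.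

Lemma inner_squareS n : inner_square n `<=` @osquare R.
Proof.
move=> p; rewrite /inner_square/= !in_itv/=.
have : 0 < n.+2%:R^-1 :> R by rewrite invr_gt0.
rewrite /osquare/=; move: n.+2%:R^-1 => c; lra.
Qed.

Lemma nondecreasing_inner_square : nondecreasing_seq inner_square.
Proof.
move=> n k nk; apply/subsetPset => p; rewrite /inner_square/= !in_itv/=.
have : k.+2%:R^-1 <= n.+2%:R^-1 :> R by rewrite lef_pV2 ?posrE// ler_nat.
move: n.+2%:R^-1 k.+2%:R^-1 => c c'; lra.
Qed.

Lemma bigcup_inner_square : \bigcup_n inner_square n = @osquare R.
Proof.
apply/seteqP; split=> [p [n _]|p [p1 p2]]; first exact: inner_squareS.
pose d := Num.min (Num.min p.1 (1 - p.1)) (Num.min p.2 (1 - p.2)).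
have d0 : 0 < d by rewrite !lt_min; lra.
have [n nd] : exists n, n.+2%:R^-1 < d :> R.
  have : \forall n \near \oo, harmonic n < d.
    by apply: (cvgr_lt (0 : R)) => //; exact: cvg_harmonic.
  (* [harmonic N.+1] is the inverse of [N.+2], the margin of [inner_square N]. *)
  move=> [N _ /(_ N.+1 (leqnSn N))]; by exists N.
exists n => //; rewrite /inner_square/= !in_itv/=.
move: nd; rewrite !lt_min; move: n.+2%:R^-1 => c; lra.
Qed.

End plane_measurability.

(** The square of [l * z - y] is nonnegative. The weight [l] is free: a small one tames a factor [z]
    that is merely bounded in L^2, at the price of a large multiple of [y ^+ 2]. *)
Lemma weighted_AMGM (R : realFieldType) (l c y z : R) : 0 < l -> 0 <= c ->
  `|z * (y * c)| <= l / 2 * (z ^+ 2 * c) + (2 * l)^-1 * (y ^+ 2 * c).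
Proof.
move=> l0 c0; rewrite mulrA normrM (ger0_norm c0) normrM.
rewrite -(real_normK (num_real y)) -(real_normK (num_real z)).
move: `|y| `|z| => {}y {}z.
have -> : l / 2 * (z ^+ 2 * c) + (2 * l)^-1 * (y ^+ 2 * c) =
    z * y * c + (2 * l)^-1 * (l * z - y) ^+ 2 * c by field; rewrite gt_eqF.
by rewrite lerDl mulr_ge0// mulr_ge0 ?sqr_ge0// invr_ge0 mulr_ge0// ltW.
Qed.

(** Near-covering compactness, applied to the filter of lists that contain a given finite list. A
    list, rather than a finite set of opens, suits the induction of [step_approximation]. *)
Lemma finite_point_cover (T : topologicalType) (K : set T) (V : T -> set T) :
  compact K -> (forall q, K q -> open (V q) /\ V q q) ->
  exists s : seq T, (forall q, q \in s -> K q) /\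
    forall p, K p -> exists2 q, q \in s & V q p.
Proof.
move=> /compact_near_coveringP cK KV.
pose F := filter_from [set: seq T] (fun s => [set t : seq T | {subset s <= t}]).
have FF : Filter F.
  apply: filter_from_filter; first by exists [::].
  move=> s t _ _; exists (s ++ t) => // u stu.
  by split=> q qs; apply: stu; rewrite mem_cat qs ?orbT.
have [|s _ sK] := cK (seq T) F (fun s p => exists2 q, q \in s & K q /\ V q p) FF.
  move=> x Kx; have [oV Vx] := KV x Kx.
  exists (V x, [set t : seq T | x \in t]).
    split; first exact: open_nbhs_nbhs.
    by exists [:: x] => // t; apply; rewrite mem_head.
  by move=> [p t] /= [Vp xt]; exists x.
exists [seq q <- s | `[< K q >]]; split.
  by move=> q; rewrite mem_filter => /andP[/asboolP].
move=> p Kp; have [//|q qs [Kq Vqp]] := sK s _ p Kp.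
by exists q => //; rewrite mem_filter qs andbT; exact/asboolP.
Qed.

Lemma cvg_pair_cst (T S : topologicalType) (x : T) (y : S) :
  (fun z => (x, z)) @ y --> (x, y).
Proof.
move=> A [[B C] [/= Bx Cy] BCA]; apply: filterS Cy => z Cz.
by apply: BCA; split=> //; exact: nbhs_singleton.
Qed.

Lemma compact_max_ball_center (R : realType) (x0 : R3 R) (r : R) :
  compact [set x : R3 R | `|x - x0| <= r].
Proof.
have -> : [set x : R3 R | `|x - x0| <= r] =
    (fun z => z + x0) @` [set z | `|z| <= r].
  apply/seteqP; split=> [x xr|_ [z zr <-]] /=; last by rewrite addrK.
  by exists (x - x0); rewrite ?subrK.
apply: continuous_compact; last exact: compact_max_ball.
apply: continuous_subspaceT => z; apply: cvgD; [exact: cvg_id|exact: cvg_cst].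
Qed.

(* The squares of [N x] are bounded in the mean over [p], locally uniformly in
   [x], but no integrable function dominates [N x p] for all [x].  On an inner
   square [N] is therefore replaced by finite sums of harmonic functions
   [c * N x q], and the remaining frame is estimated by AM-GM. *)
Section parameter_integral.
Variables (R : realType) (U : set (R3 R)) (N : R3 R -> R2 R -> R).
Variables (a f : R2 R -> R).
Local Notation E := (@osquare R).
Local Notation T2 := (measurableTypeR R * measurableTypeR R)%type.
Hypothesis U_open : open U.
Hypothesis a_continuous : forall p, E p -> {for p, continuous a}.
Hypothesis a_ge0 : forall p, E p -> 0 <= a p.
Hypothesis a_bounded : exists C, forall p, E p -> a p <= C.
Hypothesis f_measurable : measurable_fun (E : set T2) (f : T2 -> measurableTypeR R).
Hypothesis f_L2 : (\int[leb2 R]_(p in E) ((f p) ^+ 2 * a p)%:E < +oo)%E.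
Hypothesis N_harmonic : forall p, E p -> harmonic_on U (N ^~ p).
Hypothesis N_continuous : forall x p, U x -> E p ->
  {for (x, p), continuous (fun z : R3 R * R2 R => N z.1 z.2)}.
Hypothesis N_L2 : forall x0, U x0 -> exists M : R, \forall x \near x0,
  (\int[leb2 R]_(p in E) ((N x p) ^+ 2 * a p)%:E <= M%:E)%E.

Let mE : measurable (E : set T2) := @measurable_osquare R.

Let ma : measurable_fun (E : set T2) (a : T2 -> R).
Proof. by apply: continuous_measurable_plane a_continuous; exact: open_osquare. Qed.

Let mN x : U x -> measurable_fun (E : set T2) (N x : T2 -> R).
Proof.
move=> Ux; apply: continuous_measurable_plane; first exact: open_osquare.
move=> p Ep; apply: (cvg_comp (fun p => (x, p)) (fun z => N z.1 z.2) _ (N_continuous Ux Ep)).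
exact: cvg_pair_cst.
Qed.

Let sqr_integrable (g : R2 R -> R) : measurable_fun (E : set T2) (g : T2 -> R) ->
  (\int[leb2 R]_(p in E) ((g p) ^+ 2 * a p)%:E < +oo)%E ->
  (leb2 R).-integrable E (EFin \o (fun p => g p ^+ 2 * a p)).
Proof.
move=> mg g2; apply/integrableP; split.
  by apply/measurable_EFinP; apply: measurable_funM => //; exact: measurable_funX.
rewrite (_ : (\int[_]_(_ in _) _)%E = (\int[leb2 R]_(p in E) ((g p) ^+ 2 * a p)%:E)%E)//.
apply: eq_integral => p; rewrite inE => Ep.
by rewrite /= ger0_norm// mulr_ge0 ?sqr_ge0 ?a_ge0.
Qed.

Let f2_integrable : (leb2 R).-integrable E (EFin \o (fun p => f p ^+ 2 * a p)).
Proof. exact: sqr_integrable. Qed.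

Let N2_integrable x : U x ->
  (leb2 R).-integrable E (EFin \o (fun p => N x p ^+ 2 * a p)).
Proof.
move=> Ux; apply: sqr_integrable; first exact: mN.
have [M /nbhs_singleton NM] := N_L2 Ux.
by rewrite (le_lt_trans NM)// ltry.
Qed.

Let a_integrable : (leb2 R).-integrable E (EFin \o a).
Proof.
apply: measurable_bounded_integrable => //; first exact: leb2_osquare.
have [C aC] := a_bounded; exists (C%R); split; first exact: num_real.
move=> y Cy p Ep /=; rewrite ger0_norm ?a_ge0//.
by rewrite (le_trans (aC p Ep))// ltW.
Qed.

Let W p := f p * a p.

Let W_integrable : (leb2 R).-integrable E (EFin \o W).
Proof.
(* Domination by [|f| <= f ^+ 2 + 1]; the term [a] is integrable, being bounded on a set of finite
   measure. *)
apply: (@le_integrable _ _ _ _ _ mE _ (EFin \o (fun p => f p ^+ 2 * a p + a p))).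
- by apply/measurable_EFinP; exact: measurable_funM.
- move=> p Ep; rewrite /= lee_fin /W normrM (ger0_norm (a_ge0 Ep)).
  have a0 := a_ge0 Ep; rewrite [leRHS]ger0_norm; last first.
    by rewrite addr_ge0// mulr_ge0 ?sqr_ge0.
  rewrite -[X in _ + X]mul1r -mulrDl ler_wpM2r// -real_normK ?num_real//.
  by have := normr_ge0 (f p); move: `|f p| => y; nra.
- by rewrite (_ : _ \o _ = (EFin \o (fun p => f p ^+ 2 * a p)) \+ (EFin \o a))//;
    exact: integrableD.
Qed.

Let NW_integrable x : U x -> (leb2 R).-integrable E (EFin \o (fun p => N x p * W p)).
Proof.
move=> Ux; apply: (@le_integrable _ _ _ _ _ mE _
  (EFin \o (fun p => f p ^+ 2 * a p + N x p ^+ 2 * a p))).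
- apply/measurable_EFinP; apply: measurable_funM; first exact: mN.
  exact: measurable_funM.
- move=> p Ep; rewrite /= lee_fin /W mulrA normrM (ger0_norm (a_ge0 Ep)).
  have a0 := a_ge0 Ep; rewrite [leRHS]ger0_norm; last first.
    by rewrite addr_ge0// mulr_ge0 ?sqr_ge0.
  rewrite -mulrDl ler_wpM2r// normrM.
  rewrite -[f p ^+ 2]real_normK ?num_real// -[N x p ^+ 2]real_normK ?num_real//.
  by have := normr_ge0 (f p); have := normr_ge0 (N x p);
    move: `|f p| `|N x p| => y z; nra.
- rewrite (_ : _ \o _ = (EFin \o (fun p => f p ^+ 2 * a p)) \+
    (EFin \o (fun p => N x p ^+ 2 * a p)))//.
  by apply: integrableD => //; exact: N2_integrable.
Qed.

Let sub_integrable (A : set T2) (g : T2 -> R) : measurable A -> A `<=` E ->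
  (leb2 R).-integrable E (EFin \o g) -> (leb2 R).-integrable A (EFin \o g).
Proof. by move=> mA AE; exact: integrableS. Qed.

(** Monotone convergence along the exhaustion. Only [f] is involved, so the square found serves all
    [x] at once. *)
Let f2_tail (e : R) : 0 < e -> exists n,
  \int[leb2 R]_(p in E `\` @inner_square R n) (f p ^+ 2 * a p) < e.
Proof.
move=> e0.
have mQ n : measurable (@inner_square R n : set T2).
  by apply: compact_measurable_plane; exact: compact_inner_square.
have f2_ge0 p : E p -> (0 <= (f p ^+ 2 * a p)%:E)%E.
  by move=> Ep; rewrite lee_fin mulr_ge0 ?sqr_ge0 ?a_ge0.
have mf2 : measurable_fun (E : set T2) (fun p => (f p ^+ 2 * a p)%:E : \bar R).
  exact: measurable_int f2_integrable.
have := @ge0_nondecreasing_set_cvg_integral _ T2 R (@inner_square R)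
  (fun p => (f p ^+ 2 * a p)%:E) (leb2 R) (@nondecreasing_inner_square R) mQ.
rewrite bigcup_inner_square.
have QE n := @inner_squareS R n.
move=> H; have {}H : (\int[leb2 R]_(p in @inner_square R n) (f p ^+ 2 * a p)%:E)%E
    @[n --> \oo] --> (\int[leb2 R]_(p in E) (f p ^+ 2 * a p)%:E)%E.
  apply: H => [n|n p /QE/f2_ge0//]; exact: measurable_funS (@QE n) mf2.
have fin_E : (\int[leb2 R]_(p in E) (f p ^+ 2 * a p)%:E)%E \is a fin_num.
  exact: integrable_fin_num f2_integrable.
move: H; rewrite -(fineK fin_E) => /fine_cvg/cvgrPdist_lt/(_ _ e0)[n _ /(_ n (leqnn n)) /=].
move=> nE; exists n.
have dQ : E = @inner_square R n `|` (E `\` @inner_square R n) by rewrite setDUK.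
have := @Rintegral_setU _ T2 R (leb2 R) (@inner_square R n) (E `\` @inner_square R n)
   (fun p => f p ^+ 2 * a p) (mQ n) (measurableD mE (mQ n)).
rewrite -dQ => /(_ f2_integrable) H.
have dis : @inner_square R n `&` (E `\` @inner_square R n) `<=` set0.
  by move=> p [Qp [_]].
have {}H := H (introT disj_setPS dis).
move: nE; rewrite -/(Rintegral _ _ _) -/(Rintegral _ _ _) H.
by rewrite addrAC subrr add0r => /ltr_normlW.
Qed.


(** A tube argument: joint continuity of [N] at the points [(x, p0)], made uniform over the compact
    [B]. *)
Let near_constant (B : set (R3 R)) p0 (e : R) : compact B -> B `<=` U -> E p0 -> 0 < e ->
  exists V : set (R2 R), [/\ open V, V p0 &
    forall x p, B x -> V p -> `|N x p - N x p0| <= e].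
Proof.
move=> /compact_near_coveringP cB BU Ep0 e0.
have nA : \forall p \near p0, B `<=` (fun x => `|N x p - N x p0| <= e).
  apply: (cB (R2 R) (nbhs p0) (fun p x => `|N x p - N x p0| <= e)) => x Bx.
  have Nx := N_continuous (BU _ Bx) Ep0.
  have e20 : 0 < e / 2 by lra.
  have /cvgrPdist_lt/(_ _ e20) [[A C] /= [nA nC] AC] := Nx.
  exists (A, C) => // -[x' p] /= [Ax Cp].
  have := AC (x', p) (conj Ax Cp); have := AC (x', p0) (conj Ax (nbhs_singleton nC)).
  rewrite /= !ltr_norml ler_norml; lra.
exists [set p | B `<=` (fun x => `|N x p - N x p0| <= e)]°.
split=> //; first exact: open_interior.
by move=> x p Bx /interior_subset/(_ x Bx).
Qed.

(** Induction on the list of centers: on [A] inside [V q] the kernel is frozen at [q], and the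
    remainder of [A] is covered by the other centers. Peeling off pieces this way keeps them
    disjoint. *)
Let step_approximation (B : set (R3 R)) (e : R) (s : seq (R2 R)) (V : R2 R -> set (R2 R)) :
  B `<=` U -> 0 < e ->
  (forall q, q \in s -> E q /\ open (V q) /\
     forall x p, B x -> V q p -> `|N x p - N x q| <= e) ->
  forall A : set T2, measurable A -> A `<=` E ->
  (forall p, A p -> exists2 q, q \in s & V q p) ->
  exists h, harmonic_on U h /\ forall x, B x ->
    `|h x - \int[leb2 R]_(p in A) (N x p * W p)| <= e * \int[leb2 R]_(p in A) `|W p|.
Proof.
move=> BU e0; elim: s => [|q s IHs] Vs A mA AE As.
  have -> : A = set0.
    by apply/seteqP; split=> // p /As[].
  exists (fun=> 0); split; first exact: harmonic_on_cst.
  by move=> x _; rewrite !Rintegral_set0 subrr normr0 mulr0.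
have [Eq [oV VN]] := Vs q (mem_head _ _).
have mV : measurable (V q : set T2) by exact: open_measurable_plane.
have mA1 : measurable (A `&` V q : set T2) by exact: measurableI.
have mA2 : measurable (A `\` V q : set T2) by exact: measurableD.
have A1E : A `&` V q `<=` E by move=> p [/AE].
have A2E : A `\` V q `<=` E by move=> p [/AE].
have [h [hU hB]] : exists h, harmonic_on U h /\ forall x, B x ->
    `|h x - \int[leb2 R]_(p in A `\` V q) (N x p * W p)| <=
      e * \int[leb2 R]_(p in A `\` V q) `|W p|.
  apply: IHs => //.
    by move=> q' q's; apply: Vs; rewrite inE q's orbT.
  move=> p [Ap nVp]; have [q'] := As p Ap.
  by rewrite inE => /orP[/eqP -> //|q's]; exists q'.
(* This weight does not depend on [x], so [c * N x q] is harmonic in [x]. *)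
pose c := \int[leb2 R]_(p in A `&` V q) W p.
exists (fun x => c * N x q + 1 * h x); split.
  exact: (harmonic_onD c 1 U_open (N_harmonic Eq) hU).
move=> x Bx; have Ux := BU _ Bx.
have dA : A = (A `&` V q) `|` (A `\` V q) by rewrite setUIDK.
have dis : [disjoint A `&` V q & A `\` V q].
  by apply/disj_setPS => p [[_ +] [_]].
have nW : (leb2 R).-integrable E (EFin \o (fun p => `|W p|)).
  exact: integrable_norm.
have split_int (g : R2 R -> R) : (leb2 R).-integrable E (EFin \o g) ->
    \int[leb2 R]_(p in A) g p =
    \int[leb2 R]_(p in A `&` V q) g p + \int[leb2 R]_(p in A `\` V q) g p.
  move=> ig; rewrite {1}dA; apply: (@Rintegral_setU _ T2 R (leb2 R)) => //.
  by rewrite -dA; exact: sub_integrable.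
rewrite (split_int (fun p => N x p * W p)); last exact: NW_integrable.
rewrite (split_int (fun p => `|W p|))// mulrDr mul1r.
have -> : forall a b c d : R, a + b - (c + d) = (a - c) + (b - d) by move=> *; ring.
rewrite (le_trans (ler_normD _ _))// lerD//; last exact: hB.
have iNW : (leb2 R).-integrable (A `&` V q) (EFin \o (fun p => N x p * W p)).
  by apply: sub_integrable => //; exact: NW_integrable.
have iW : (leb2 R).-integrable (A `&` V q) (EFin \o W) by exact: sub_integrable.
have inW : (leb2 R).-integrable (A `&` V q) (EFin \o (fun p => `|W p|)).
  exact: sub_integrable.
have iqW : (leb2 R).-integrable (A `&` V q) (EFin \o (fun p => N x q * W p)).
  exact: (integrableZl mA1 (N x q) iW).
rewrite mulrC /c -(RintegralZl _ mA1 iW) -(RintegralB mA1 iqW iNW).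
have iD : (leb2 R).-integrable (A `&` V q)
    (EFin \o (fun p => N x q * W p - N x p * W p)).
  exact: (integrableB mA1 iqW iNW).
rewrite (le_trans (le_normr_Rintegral mA1 iD))// -(RintegralZl _ mA1 inW).
apply: le_Rintegral => //.
- exact: integrable_norm.
- exact: (integrableZl mA1 e inW).
- move=> p [Ap Vp]; rewrite -mulrBl normrM ler_wpM2r// distrC.
  exact: VN.
Qed.

Let patch_split (n : nat) (g : R2 R -> R) : (leb2 R).-integrable E (EFin \o g) ->
  \int[leb2 R]_(p in E) g p = \int[leb2 R]_(p in @inner_square R n) g p +
  \int[leb2 R]_(p in E `\` @inner_square R n) g p.
Proof.
move=> ig.
have dQ : E = @inner_square R n `|` (E `\` @inner_square R n).
  by rewrite setDUK//; exact: inner_squareS.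
have mQ : measurable (@inner_square R n : set T2).
  by apply: compact_measurable_plane; exact: compact_inner_square.
rewrite {1}dQ; apply: (@Rintegral_setU _ T2 R (leb2 R)) => //.
- exact: measurableD.
- by rewrite -dQ.
- by apply/disj_setPS => p [Qp [_]].
Qed.

Lemma parameter_integral_integrable x : U x ->
  (leb2 R).-integrable E (EFin \o (fun p => N x p * (f p * a p))).
Proof. exact: NW_integrable. Qed.

Lemma parameter_integral_harmonic :
  harmonic_on U (fun x => \int[leb2 R]_(p in E) (N x p * (f p * a p))).
Proof.
apply: harmonic_on_approximable => x0 Ux0.
have [M nM] := N_L2 Ux0.
have : \forall x \near x0, U x /\
    (\int[leb2 R]_(p in E) ((N x p) ^+ 2 * a p)%:E <= M%:E)%E.
  by apply: filterI => //; exact: open_nbhs_nbhs.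
move=> /nbhs_ballP[r /= r0 rU]; exists (r / 2); first by rewrite divr_gt0.
pose B := [set x : R3 R | `|x - x0| <= r / 2].
have BU x : B x -> U x /\
    (\int[leb2 R]_(p in E) ((N x p) ^+ 2 * a p)%:E <= M%:E)%E.
  move=> Bx; apply: rU; rewrite prod_norm_ball /ball_/= distrC (le_lt_trans Bx)//.
  by rewrite ltr_pdivrMr// ltr_pMr// ltr1n.
have cB : compact B by exact: compact_max_ball_center.
(* [M'] is a positive bound, fit to be a denominator. With [l = e / (2 * M')] and a tail below
   [l * e / 2], each of the two AM-GM terms is at most [e / 4]. *)
move=> e e0; pose M' := `|M| + 1.
have M'0 : 0 < M' by rewrite ltr_wpDl.
pose l := e / (2 * M').
have l0 : 0 < l by rewrite divr_gt0// mulr_gt0.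
have [|n tail] := @f2_tail (l * e / 2); first by rewrite divr_gt0// mulr_gt0.
set Q := @inner_square R n in tail.
have QE : Q `<=` E by exact: inner_squareS.
have cQ : compact Q by exact: compact_inner_square.
have mQ : measurable (Q : set T2) by exact: compact_measurable_plane.
have mEQ : measurable (E `\` Q : set T2) by exact: measurableD.
have EQE : E `\` Q `<=` E by move=> p [].
pose I := \int[leb2 R]_(p in Q) `|W p|.
have I0 : 0 <= I by exact: Rintegral_ge0.
(* Makes [e' * I] at most [e / 2]; the added 1 covers the case [I = 0]. *)
pose e' := e / (2 * (I + 1)).
have I10 : 0 < I + 1 by rewrite ltr_wpDl.
have e'0 : 0 < e' by rewrite divr_gt0// mulr_gt0.
have /choice[V VP] : forall q, exists V : set (R2 R), E q -> [/\ open V, V q &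
    forall x p, B x -> V p -> `|N x p - N x q| <= e'].
  move=> q; have [Eq|] := pselect (E q); last by exists setT.
  have [|V VP] := near_constant cB _ Eq e'0; first by move=> x /BU[].
  by exists V.
have [|s [sQ Qs]] := @finite_point_cover _ Q V cQ.
  by move=> q /QE/VP[].
have [||h [hU hB]] := @step_approximation B e' s V _ e'0 _ Q mQ QE Qs.
- by move=> x /BU[].
- by move=> q /sQ/QE Eq; have [oV _ VN] := VP q Eq.
exists h; split.
  by apply: harmonic_onS hU => x /ltW/BU[].
move=> x /ltW xr; have [Ux NM] := BU x xr.
rewrite (patch_split n (NW_integrable Ux)) opprD addrA.
rewrite (le_trans (ler_normD _ _))// normrN (splitr e) lerD//.
  rewrite (le_trans (hB x xr))// -/I /e'.
  rewrite mulrAC ler_pdivrMr ?mulr_gt0//.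
  have -> : e / 2 * (2 * (I + 1)) = e * I + e by field.
  by rewrite lerDl ltW.
have iNW : (leb2 R).-integrable (E `\` Q) (EFin \o (fun p => N x p * W p)).
  by apply: sub_integrable => //; exact: NW_integrable.
have iN2 : (leb2 R).-integrable (E `\` Q) (EFin \o (fun p => N x p ^+ 2 * a p)).
  by apply: sub_integrable => //; exact: N2_integrable.
have if2 : (leb2 R).-integrable (E `\` Q) (EFin \o (fun p => f p ^+ 2 * a p)).
  exact: sub_integrable.
have iN2l : (leb2 R).-integrable (E `\` Q)
    (EFin \o (fun p => l / 2 * (N x p ^+ 2 * a p))).
  exact: (integrableZl mEQ (l / 2) iN2).
have if2l : (leb2 R).-integrable (E `\` Q)
    (EFin \o (fun p => (2 * l)^-1 * (f p ^+ 2 * a p))).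
  exact: (integrableZl mEQ (2 * l)^-1 if2).
rewrite (le_trans (le_normr_Rintegral mEQ iNW))//.
have : \int[leb2 R]_(p in E `\` Q) `|N x p * W p| <=
    \int[leb2 R]_(p in E `\` Q)
      (l / 2 * (N x p ^+ 2 * a p) + (2 * l)^-1 * (f p ^+ 2 * a p)).
  apply: le_Rintegral => //.
  - exact: integrable_norm.
  - exact: (integrableD mEQ iN2l if2l).
  - by move=> p [Ep _]; apply: weighted_AMGM => //; exact: a_ge0.
move=> /le_trans; apply.
rewrite (RintegralD mEQ iN2l if2l) (RintegralZl _ mEQ iN2) (RintegralZl _ mEQ if2).
have N2M : \int[leb2 R]_(p in E `\` Q) (N x p ^+ 2 * a p) <= M'.
  have : \int[leb2 R]_(p in E) (N x p ^+ 2 * a p) <= M.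
    by rewrite -lee_fin /Rintegral fineK//; exact: integrable_fin_num (N2_integrable Ux).
  rewrite (patch_split n (N2_integrable Ux)) -/Q.
  have : 0 <= \int[leb2 R]_(p in Q) (N x p ^+ 2 * a p).
    by apply: Rintegral_ge0 => p /QE Ep; rewrite mulr_ge0 ?sqr_ge0 ?a_ge0.
  have := ler_norm M; rewrite /M'; lra.
have -> : e / 2 = l / 2 * M' + (2 * l)^-1 * (l * e / 2).
  by rewrite /l; field; rewrite !gt_eqF.
apply: (lerD (ler_wpM2l _ N2M) (ler_wpM2l _ (ltW tail))).
  by apply: divr_ge0 => //; exact: ltW.
by rewrite invr_ge0; apply: mulr_ge0 => //; exact: ltW.
Qed.

End parameter_integral.

(** * Normal derivatives at the boundary *)

Section outward_normals.
Variable R : realType.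
Implicit Types (A : set (R3 R)) (u v y n : R3 R) (s t : R).

Lemma dotC u v : dot u v = dot v u.
Proof. by rewrite /dot /=; ring. Qed.

Lemma dotZl s u v : dot (s *: u) v = s * dot u v.
Proof. by rewrite /dot /= /GRing.scale/=; ring. Qed.

Lemma dotNl u v : dot (- u) v = - dot u v.
Proof. by rewrite -scaleN1r dotZl mulN1r. Qed.

Lemma dotNr u v : dot u (- v) = - dot u v.
Proof. by rewrite dotC dotNl dotC. Qed.

Lemma dotBl u v n : dot (u - v) n = dot u n - dot v n.
Proof. by rewrite /dot /=; ring. Qed.

Lemma enorm_ge0 u : 0 <= enorm u.
Proof. exact: sqrtr_ge0. Qed.

Lemma enormZ s u : 0 <= s -> enorm (s *: u) = s * enorm u.
Proof.
move=> s0; rewrite /enorm dotZl dotC dotZl mulrA -expr2 sqrtrM ?sqr_ge0//.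
by rewrite sqrtr_sqr ger0_norm.
Qed.

Lemma enormN u : enorm (- u) = enorm u.
Proof. by rewrite /enorm dotNl dotNr opprK. Qed.

Lemma dot_gt0 u : u != 0 -> 0 < dot u u.
Proof.
move=> u0; have [i ui] := norm_coord u.
apply: lt_le_trans (dot_ge_coord i u).
by rewrite exprn_even_gt0//= -normr_gt0 -ui normr_gt0.
Qed.

Lemma cvg_scale_right u : (t *: u) @[t --> (0 : R)^'+] --> (0 : R3 R).
Proof.
rewrite -(scale0r u); apply: cvgZr_tmp; apply: cvg_at_right_filter; exact: cvg_id.
Qed.

(** Along [d = n - n'], which has positive product with [n] and negative product with [n'], the
    points near [y] would be both outside [A] and interior to [A]. *)
Lemma outward_normal_unique A y n n' :
  is_outward_normal A y n -> is_outward_normal A y n' -> n = n'.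
Proof.
move=> [n1 An] [n'1 An']; apply/eqP; rewrite -subr_eq0.
apply/negPn/negP => nn'; set d := n - n' in nn'.
pose c := dot n n'.
have dd : dot d d = 2 - 2 * c.
  by rewrite /d dotBl ![dot _ (n - n')]dotC !dotBl n1 n'1 (dotC n' n) -/c; ring.
have c1 : c < 1 by have := dot_gt0 nn'; rewrite dd; lra.
(* The aperture is taken so that [e * enorm d < 1 - c], which places [d] in both cones; the added 1
   keeps the denominator positive. *)
have e0 : 0 < (1 - c) / (enorm d + 1).
  by rewrite divr_gt0 ?subr_gt0// ltr_wpDl// enorm_ge0.
have ed : (1 - c) / (enorm d + 1) * enorm d < 1 - c.
  rewrite mulrAC ltr_pdivrMr ?ltr_wpDl ?enorm_ge0//.
  by rewrite ltr_pM2l ?subr_gt0// ltrDl.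
have := An _ e0; have := An' _ e0; move: ed; set e := _ / _ => ed nA' nA.
have [t [t0 [_ At] [nAt _]]] : exists t, [/\ 0 < t,
   (e * enorm (t *: d) < dot (t *: d) n' -> ~ A (y + t *: d)) /\
   (dot (t *: d) n' < - (e * enorm (t *: d)) -> A° (y + t *: d)) &
   (e * enorm (t *: d) < dot (t *: d) n -> ~ A (y + t *: d)) /\
   (dot (t *: d) n < - (e * enorm (t *: d)) -> A° (y + t *: d))].
  have [t tP] := @filter_ex _ _ _ _
    (filterI (nbhs_right_gt 0) (filterI (cvg_scale_right d nA') (cvg_scale_right d nA))).
  by move: tP => [t0 [? ?]]; exists t; split.
apply: nAt; last first.
  apply: interior_subset; apply: At.
  rewrite enormZ ?ltW// dotZl mulrCA -mulrN ltr_pM2l//.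
  by rewrite /d dotBl n'1 -/c; lra.
rewrite enormZ ?ltW// dotZl mulrCA ltr_pM2l// /d dotBl n1 (dotC n' n) -/c.
exact: ed.
Qed.

Lemma outward_normalE A y n : is_outward_normal A y n -> outward_normal A y = n.
Proof.
move=> An; apply: (@outward_normal_unique A y) => //.
by apply: (@xgetPex _ 0 [set n | is_outward_normal A y n]); exists n.
Qed.

Lemma inward_interior A y n : is_outward_normal A y n ->
  \forall t \near (0 : R)^'+, A° (y - t *: n).
Proof.
(* Any aperture below 1 would do, since [- n] is the axis of the inner cone. *)
move=> [n1 An]; have h0 : (0 : R) < 1 / 2 by [].
have nA := cvg_scale_right (- n) (An _ h0).
near=> t; have t0 : 0 < t by near: t; exact: nbhs_right_gt.
rewrite -scalerN.
have [_] : (1 / 2 * enorm (t *: - n) < dot (t *: - n) n -> ~ A (y + t *: - n)) /\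
   (dot (t *: - n) n < - (1 / 2 * enorm (t *: - n)) -> A° (y + t *: - n)) by near: t.
apply; rewrite enormZ ?ltW// enormN dotZl dotNl n1 /enorm n1 sqrtr1; lra.
Unshelve. all: by end_near. Qed.

End outward_normals.

(** Differentiability is asked only for positive arguments, with right continuity at 0, because 0
    will stand for a boundary point. *)
Lemma right_mean_value (R : realType) (h h' : R -> R) (c e t : R) : 0 < t ->
  h s @[s --> 0^'+] --> h 0 ->
  (forall s : R, 0 < s <= t -> is_derive s 1 h (h' s) /\ `|h' s - c| <= e) ->
  `|(h t - h 0) / t - c| <= e.
Proof.
move=> t0 h0 hh'.
have dh (s : R) : 0 < s < t -> is_derive s 1 h (h' s).
  by move=> /andP[s0 st]; apply: (hh' s _).1; rewrite s0 ltW.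
have ch : {within `[0, t], continuous h}.
  apply/continuous_within_itvP => //; split => //.
    by move=> s; rewrite in_itv/= => /dh; exact: is_derive_continuous.
  apply: cvg_at_left_filter; apply: (@is_derive_continuous _ _ _ (h' t)).
  by apply: (hh' t _).1; rewrite t0 lexx.
have [s /andP[s0 st] ->] := MVT_is_derive t0 dh ch.
by rewrite mulfK ?gt_eqF//; apply: (hh' s _).2; rewrite s0 ltW.
Qed.

Lemma within_continuous_at (T S : topologicalType) (X : set T) (f : T -> S) (x : T) :
  {within X, continuous f} -> X x -> f @ within X (nbhs x) --> f x.
Proof.
by move=> fX Xx; rewrite (nbhs_subspace_in Xx); exact: (fX x).
Qed.

Section normal_derivative_kernel.
Variables (R : realType) (U A A' : set (R3 R)) (F : R3 R -> R3 R -> R).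
Variable DF : R3 R * R3 R -> R3 R.
Implicit Types (x y n : R3 R).
Hypothesis U_open : open U.
Hypothesis A'_interior : A° `<=` A'.
Hypothesis F_continuous : forall x, U x -> {within A', continuous (F x)}.
Hypothesis DF_continuous : {within U `*` A', continuous DF}.
Hypothesis F_derive : forall x y v, U x -> A° y ->
  is_derive y v (F x) (dot (DF (x, y)) v).

(** Joint continuity of [DF] at [(x, y)] is used at [(x', y - t *: n)] and at [(x', y)], with
    [e / 2] each. Stated for [x'] near [x] to feed near-covering compactness. *)
Let kernel_near y n x (e : R) : A' y -> is_outward_normal A y n -> U x -> 0 < e ->
  \forall x' \near x & t \near (0 : R)^'+,
    A° (y - t *: n) /\ `|dot (DF (x', y - t *: n)) n - dot (DF (x', y)) n| <= e.
Proof.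
move=> A'y nn Ux e0; have e20 : 0 < e / 2 by rewrite divr_gt0.
have Dxy := within_continuous_at DF_continuous (conj Ux A'y : (U `*` A') (x, y)).
have dxy : dot (DF z) n @[z --> within (U `*` A') (nbhs (x, y))] --> dot (DF (x, y)) n.
  by apply: cvg_dot Dxy _; exact: cvg_cst.
have /cvgrPdist_lt/(_ _ e20)[[V W] /= [nV nW] VW] := dxy.
have ty : y - t *: n @[t --> (0 : R)^'+] --> y.
  rewrite -[X in _ --> X]subr0; apply: cvgB; first exact: cvg_cst.
  exact: cvg_scale_right.
exists (V `&` U, [set t | A° (y - t *: n) /\ W (y - t *: n)]) => /=.
  split; first by apply: filterI => //; exact: open_nbhs_nbhs.
  by apply: filterI; [exact: inward_interior|exact: ty].
move=> [x' t] /= [[Vx' Ux'] [At Wt]]; split => //.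
have := VW (x', y - t *: n) (conj Vx' Wt) (conj Ux' (A'_interior At)).
have := VW (x', y) (conj Vx' (nbhs_singleton nW)) (conj Ux' A'y).
rewrite !ltr_norml ler_norml; lra.
Qed.

(** By the mean value theorem the quotient is the normal component of [DF] at an intermediate point
    of the inward segment; compactness of [B] makes the estimate uniform in [x]. *)
Let quotient_near y n (B : set (R3 R)) (e : R) : A' y -> is_outward_normal A y n ->
  compact B -> B `<=` U -> 0 < e ->
  \forall t \near (0 : R)^'+, A° (y - t *: n) /\ forall x, B x ->
    `|(F x y - F x (y - t *: n)) / t - dot (DF (x, y)) n| <= e.
Proof.
move=> A'y nn /compact_near_coveringP cB BU e0.
have nB : \forall t \near (0 : R)^'+, B `<=` (fun x => A° (y - t *: n) /\
    `|dot (DF (x, y - t *: n)) n - dot (DF (x, y)) n| <= e).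
  apply: (cB R (0 : R)^'+ (fun t x => A° (y - t *: n) /\
    `|dot (DF (x, y - t *: n)) n - dot (DF (x, y)) n| <= e)) => x /BU Ux.
  exact: kernel_near.
have nA := inward_interior nn.
have [d /= d0 dP] : nbhs (0 : R)^'+ [set t | A° (y - t *: n) /\
    B `<=` (fun x => A° (y - t *: n) /\
    `|dot (DF (x, y - t *: n)) n - dot (DF (x, y)) n| <= e)].
  exact: filterI.
(* The estimate is needed at every point of the segment below [t], hence on a whole interval. *)
have {}dP (t : R) : 0 < t < d -> A° (y - t *: n) /\
    B `<=` (fun x => A° (y - t *: n) /\
    `|dot (DF (x, y - t *: n)) n - dot (DF (x, y)) n| <= e).
  by move=> /andP[t0 td]; apply: dP => //; rewrite /= sub0r normrN gtr0_norm.
near=> t.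
have t0 : 0 < t by near: t; exact: nbhs_right_gt.
have td : t < d by near: t; exact: nbhs_right_lt.
split; first by apply: (dP t _).1; rewrite t0.
move=> x Bx; have Ux := BU x Bx.
have := @right_mean_value R (fun s => - F x (y + s *: - n))
  (fun s => - dot (DF (x, y + s *: - n)) (- n)) (dot (DF (x, y)) n) e t t0.
rewrite scale0r addr0 opprK [- _ + _]addrC scalerN; apply.
- apply: cvgN; have Fy := within_continuous_at (F_continuous Ux) A'y.
  apply: cvg_comp Fy => W /= nW.
  have ty : y + t *: - n @[t --> (0 : R)^'+] --> y.
    rewrite -[X in _ --> X]addr0; apply: cvgD; first exact: cvg_cst.
    exact: cvg_scale_right.
  have := ty _ nW; apply: filterS2 nA => s As; apply.
  by rewrite scalerN; exact: A'_interior.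
- move=> s /andP[s0 st]; have sd : 0 < s < d by rewrite s0 (le_lt_trans st).
  have [As /(_ _ Bx)[_ Ds]] := dP s sd.
  split; last by rewrite dotNr opprK scalerN.
  apply: is_deriveN; apply: is_derive_line; rewrite scalerN.
  exact: F_derive.
Unshelve. all: by end_near. Qed.

Lemma normal_quotient_cvg y n x : A' y -> is_outward_normal A y n -> U x ->
  normal_quotient A (F x) y t @[t --> 0^'+] --> dot (DF (x, y)) n.
Proof.
move=> A'y nn Ux; apply/cvgrPdist_le => e e0.
have xU : [set x] `<=` U by move=> _ ->.
have nx := quotient_near A'y nn (@compact_set1 _ x) xU e0.
near=> t.
have [Ay xt] : A° (y - t *: outward_normal A y) /\ forall z, [set x] z ->
    `|(F z y - F z (y - t *: n)) / t - dot (DF (z, y)) n| <= e.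
  by rewrite (outward_normalE nn); near: t.
by rewrite /normal_quotient (outward_normalE nn) distrC; exact: xt.
Unshelve. all: by end_near. Qed.

Lemma normal_kernel_harmonic y n : A' y -> A y -> is_outward_normal A y n ->
  (forall y, A y -> harmonic_on U (fun x => F x y)) ->
  harmonic_on U (fun x => dot (DF (x, y)) n).
Proof.
move=> A'y Ay nn Fh; apply: harmonic_on_approximable => x0 Ux0.
have /nbhs_ballP[r /= r0 rU] : nbhs x0 U by exact: open_nbhs_nbhs.
exists (r / 2); first by rewrite divr_gt0.
pose B := [set x : R3 R | `|x - x0| <= r / 2].
have BU : B `<=` U.
  move=> x Bx; apply: rU; rewrite prod_norm_ball /ball_/= distrC (le_lt_trans Bx)//.
  by rewrite ltr_pdivrMr// ltr_pMr// ltr1n.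
move=> e e0.
have [t [At tB]] := filter_ex
  (quotient_near A'y nn (@compact_max_ball_center _ x0 (r / 2)) BU e0).
exists (fun x => t^-1 * F x y + (- t^-1) * F x (y - t *: n)); split.
  apply: (harmonic_onS (D' := U)); first by move=> x /ltW/BU.
  apply: (harmonic_onD _ _ U_open); first exact: Fh.
  by apply: Fh; exact: interior_subset.
move=> x /ltW xr; rewrite mulNr -mulrBr mulrC; exact: tB.
Qed.

End normal_derivative_kernel.

Section continuity.
Variable R : realType.

Lemma continuous_cross (T : topologicalType) (f g : T -> R3 R) (p : T) :
  {for p, continuous f} -> {for p, continuous g} ->
  {for p, continuous (fun q => cross (f q) (g q))}.
Proof.
move=> fp gp.
have fi i : coord i (f t) @[t --> p] --> coord i (f p).
  exact: (continuous_cvg _ (@continuous_coord R i (f p)) fp).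
have gi i : coord i (g t) @[t --> p] --> coord i (g p).
  exact: (continuous_cvg _ (@continuous_coord R i (g p)) gp).
have crossE u v : cross u v =
  (coord (lift ord0 ord0) u * coord ord_max v - coord ord_max u * coord (lift ord0 ord0) v,
   coord ord_max u * coord ord0 v - coord ord0 u * coord ord_max v,
   coord ord0 u * coord (lift ord0 ord0) v - coord (lift ord0 ord0) u * coord ord0 v)
   :> R3 R by rewrite !coordE.
rewrite /prop_for /continuous_at crossE.
have -> : (fun q => cross (f q) (g q)) = (fun q : T =>
  (coord (lift ord0 ord0) (f q) * coord ord_max (g q) -
     coord ord_max (f q) * coord (lift ord0 ord0) (g q),
   coord ord_max (f q) * coord ord0 (g q) - coord ord0 (f q) * coord ord_max (g q),
   coord ord0 (f q) * coord (lift ord0 ord0) (g q) -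
     coord (lift ord0 ord0) (f q) * coord ord0 (g q))).
  by apply/funext => q; exact: crossE.
apply: (cvg_pair (G := nbhs (_, _)) (H := nbhs _)).
  apply: (cvg_pair (G := nbhs _) (H := nbhs _)).
- by apply: cvgB; apply: cvgM.
- by apply: cvgB; apply: cvgM.
- by apply: cvgB; apply: cvgM.
Qed.

Lemma continuous_enorm (T : topologicalType) (f : T -> R3 R) (p : T) :
  {for p, continuous f} -> {for p, continuous (fun q => enorm (f q))}.
Proof.
move=> fp; apply: (continuous_cvg _ (@sqrt_continuous R (dot (f p) (f p)))).
exact: cvg_dot.
Qed.

Variables (phi : R2 R -> R3 R).

Lemma classC1_continuous p : classC1_at phi p -> {for p, continuous phi}.
Proof. by move=> [/nbhs_singleton/differentiable_continuous]. Qed.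

Lemma chart_normal_continuous p : classC1_at phi p ->
  {for p, continuous (chart_normal phi)}.
Proof.
by move=> [_ d1 d2]; exact: (@continuous_cross _ ('D_(1, 0) phi) ('D_(0, 1) phi) p d1 d2).
Qed.

Lemma area_density_continuous p : classC1_at phi p ->
  {for p, continuous (area_density phi)}.
Proof.
by move=> /chart_normal_continuous cp; exact: (@continuous_enorm _ (chart_normal phi) p cp).
Qed.

Lemma area_density_gt0 p : chart_normal phi p != 0 -> 0 < area_density phi p.
Proof. by move=> /dot_gt0; rewrite /area_density /enorm sqrtr_gt0. Qed.

(** Charts are C^1 up to the closed square, which is compact. The unit normal has no such extension,
    as the density may vanish on the edges. *)
Lemma area_density_bounded : (forall p, csquare p -> classC1_at phi p) ->
  exists C, forall p, osquare p -> area_density phi p <= C.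
Proof.
move=> phiC1.
have cc : {within @csquare R, continuous (area_density phi)}.
  apply: continuous_in_subspaceT => p; rewrite inE => /phiC1.
  exact: area_density_continuous.
have [|p _ pmax] := compact_EVT_max _ (@compact_csquare R) cc.
  by exists (0, 0); split; rewrite /= lexx ler01.
exists (area_density phi p) => q [q1 q2]; apply: pmax; rewrite inE.
by split; rewrite !ltW//; lra.
Qed.

End continuity.

(** * Layer potentials *)

Section layer_of_regular_part.
Variables (R : realType) (A U : set (R3 R)) (m : nat) (phi : 'I_m -> R2 R -> R3 R).
Variables (F : R3 R -> R3 R -> R) (f : R3 R -> R).
Hypothesis A_domain : bounded_closed_domain A.
Hypothesis A_boundary : piecewise_smooth_boundary A phi.
Hypothesis U_open : open U.
Hypothesis F_regular : regular_part phi U A F.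
Hypothesis F_harmonic : forall y, A y -> harmonic_on U (fun x => F x y).
Hypothesis f_L2 : surface_L2 phi f.

Lemma boundary_sub y : boundary A y -> A y.
Proof.
have [/compact_closed cA _ _ _] := A_domain.
by move=> [+ _]; rewrite -(iffLR (closure_id A))//; apply: cA; exact: norm_hausdorff.
Qed.

Lemma smooth_boundary_sub y : smooth_boundary_points phi y -> boundary A y.
Proof.
have [-> _ _ _ _] := A_boundary => -[i _ [p [p1 p2] <-]].
by exists i => //; exists p => //; split; rewrite !ltW//; lra.
Qed.

Let normal i p := (area_density (phi i) p)^-1 *: chart_normal (phi i) p.

Let normalP i p : osquare p -> is_outward_normal A (phi i p) (normal i p).
Proof. by have [_ _ _ _] := A_boundary; exact. Qed.

Let smooth_point i p : osquare p -> smooth_boundary_points phi (phi i p).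
Proof. by move=> Ep; exists i => //; exists p. Qed.

Let osquare_csquare p : osquare p -> csquare (p : R2 R).
Proof. by move=> [p1 p2]; split; rewrite !ltW//; lra. Qed.

Let C1 i p : osquare p -> classC1_at (phi i) p.
Proof. by have [_ + _ _ _] := A_boundary; move=> H /osquare_csquare; exact: H. Qed.

Let area_gt0 i p : osquare p -> 0 < area_density (phi i) p.
Proof.
by have [_ _ + _ _] := A_boundary; move=> H Ep; apply: area_density_gt0; exact: H.
Qed.

Lemma normal_derivable_at_smooth_point :
  exists DF : R3 R * R3 R -> R3 R,
  [/\ {within U `*` (A° `|` smooth_boundary_points phi), continuous DF},
      forall x i p, U x -> osquare p ->
        normal_quotient A (F x) (phi i p) t @[t --> 0^'+] -->
        dot (DF (x, phi i p)) (normal i p) &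
      forall i p, osquare p ->
        harmonic_on U (fun x => dot (DF (x, phi i p)) (normal i p))].
Proof.
have [Fc [DF [DFc dF]] _] := F_regular; exists DF; split => //.
  move=> x i p Ux Ep; apply: (normal_quotient_cvg U_open _ Fc DFc dF) => //.
    by right; exact: smooth_point.
  exact: normalP.
move=> i p Ep; apply: (normal_kernel_harmonic U_open _ Fc DFc dF) => //.
- by right; exact: smooth_point.
- by apply/boundary_sub/smooth_boundary_sub/smooth_point.
- exact: normalP.
Qed.

Lemma surface_sqnorm_patch (g : R3 R -> R) i :
  (\int[leb2 R]_(p in osquare (R:=R)) ((g (phi i p)) ^+ 2 * area_density (phi i) p)%:E
    <= surface_sqnorm phi g)%E.
Proof.
rewrite /surface_sqnorm (bigD1 i)//= leeDl// sume_ge0// => j _.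
by apply: integral_ge0 => p _; rewrite lee_fin mulr_ge0 ?sqr_ge0// enorm_ge0.
Qed.

(** [parameter_integral_harmonic] on each patch, with the area density as weight and the normal
    component of [DF] as kernel: this expression, unlike the limit defining [normal_derivative], is
    visibly jointly continuous. *)
Lemma regular_layer :
  (forall x, U x -> layer_defined phi A F f x) /\ harmonic_on U (layer phi A F f).
Proof.
have [DF [DFc Fcvg Nh]] := normal_derivable_at_smooth_point.
have [fm f2] := f_L2.
pose N i x p := dot (DF (x, phi i p)) (normal i p).
have nd x i p : U x -> osquare p -> normal_derivative A (F x) (phi i p) = N i x p.
  by move=> Ux Ep; apply: cvg_lim => //; exact: Fcvg.
have a_continuous i (p : R2 R) : osquare p -> {for p, continuous (area_density (phi i))}.
  by move=> Ep; apply: area_density_continuous; exact: C1.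
have a_ge0 i (p : R2 R) : osquare p -> 0 <= area_density (phi i) p.
  by move=> _; exact: enorm_ge0.
have a_bounded i : exists C, forall p, osquare p -> area_density (phi i) p <= C.
  by apply: area_density_bounded; have [_ + _ _ _] := A_boundary; exact.
have patch_L2 i : (\int[leb2 R]_(p in osquare (R:=R))
    (((f \o phi i) p) ^+ 2 * area_density (phi i) p)%:E < +oo)%E.
  exact: le_lt_trans (surface_sqnorm_patch f i) f2.
have N_continuous i x p : U x -> osquare p ->
    {for (x, p), continuous (fun z : R3 R * R2 R => N i z.1 z.2)}.
  move=> Ux Ep.
  have phic : {for p, continuous (phi i)} by apply: classC1_continuous; exact: C1.
  have A'p : (U `*` (A° `|` smooth_boundary_points phi)) (x, phi i p).
    by split => //; right; exact: smooth_point.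
  have /= D1 := within_continuous_at DFc A'p.
  apply: cvg_dot.
    apply: cvg_comp D1 => W /= [[V V'] /= [nV nV'] VW].
    (* Continuity of [DF] is only relative to [U] times the interior and smooth boundary points, so
       the neighborhoods are cut down to stay there. *)
    exists (V `&` U, phi i @^-1` V' `&` osquare (R:=R)) => /=.
      split; first by apply: filterI => //; exact: open_nbhs_nbhs.
      apply: filterI; first exact: phic.
      by apply: open_nbhs_nbhs; split => //; exact: open_osquare.
    move=> [x' p'] /= [[Vx' Ux'] [Vp' Ep']].
    apply: (VW (x', phi i p') (conj Vx' Vp')); split => //.
    by right; exact: smooth_point.
  have nc : {for p, continuous (normal i)}.
    apply: cvgZ; last by apply: chart_normal_continuous; exact: C1.
    by apply: cvgV; [rewrite gt_eqF// area_gt0|exact: a_continuous].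
  apply: (cvg_comp (fun z : R3 R * R2 R => z.2) (normal i) _ nc); exact: cvg_snd.
have N_L2 i x0 : U x0 -> exists M : R, \forall x \near x0,
    (\int[leb2 R]_(p in osquare (R:=R))
      ((N i x p) ^+ 2 * area_density (phi i) p)%:E <= M%:E)%E.
  move=> Ux0; have [_ _ /(_ x0 Ux0)[M nM]] := F_regular; exists M.
  have : \near x0, U x0 by exact: open_nbhs_nbhs.
  apply: filterS2 nM => x FM Ux; apply: le_trans FM.
  rewrite (le_trans _ (surface_sqnorm_patch _ i))//.
  rewrite le_eqVlt; apply/orP; left; apply/eqP; apply: eq_integral => p.
  by rewrite inE => Ep; rewrite nd.
have kernelE i x : U x -> {in osquare (R:=R), forall p,
    normal_derivative A (F x) (phi i p) * f (phi i p) * area_density (phi i) p =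
    N i x p * ((f \o phi i) p * area_density (phi i) p)}.
  by move=> Ux p; rewrite inE => Ep; rewrite nd// mulrA.
split.
  move=> x Ux; split.
    by move=> _ [i _ [p Ep <-]]; apply/cvg_ex; exists (N i x p); exact: Fcvg.
  move=> i; have := parameter_integral_integrable (a_continuous i) (a_ge0 i) (fm i)
    (patch_L2 i) (N_continuous i) (N_L2 i) Ux.
  apply: eq_integrable; first exact: measurable_osquare.
  by move=> p Ep /=; rewrite kernelE.
have h i := parameter_integral_harmonic U_open (a_continuous i) (a_ge0 i) (a_bounded i)
  (fm i) (patch_L2 i) (Nh i) (N_continuous i) (N_L2 i).
have hs := harmonic_on_sum (index_enum 'I_m) U_open h.
apply: eq_harmonic_on (harmonic_onD (-1) 0 U_open hs hs) => // x Ux.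
rewrite mul0r addr0 mulN1r /layer /surface_integral; congr (- _).
by apply: eq_bigr => i _; apply: eq_Rintegral => p Ep; rewrite kernelE.
Qed.

End layer_of_regular_part.

(** * The singular part and the decomposition of the solution *)

(** The decomposition may fail at [y = x], but [x] is interior and [y] is not, so the points
    [y - t *: n] with small [t] stay in [A] and avoid [x]. *)
Lemma singular_normal_quotient (R : realType) (A : set (R3 R)) (G S F : R3 R -> R3 R -> R)
    (x y n : R3 R) (g k : R) :
  green_decomposition A G S F -> A° x -> A y -> ~ A° y -> is_outward_normal A y n ->
  normal_quotient A (G x) y t @[t --> 0^'+] --> g ->
  normal_quotient A (F x) y t @[t --> 0^'+] --> k ->
  normal_quotient A (S x) y t @[t --> 0^'+] --> g - k.
Proof.
move=> GSF Ax Ay nAy nn Gg Fk.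
have yx : y != x by apply: contra_notN nAy => /eqP ->.
have SE z : A z -> z != x -> S x z = G x z - F x z.
  by move=> Az zx; rewrite (GSF x z)// addrK.
apply: cvg_trans (cvgB Gg Fk); apply: near_eq_cvg.
have ty : y - t *: n @[t --> (0 : R)^'+] --> y.
  rewrite -[X in _ --> X]subr0; apply: cvgB; first exact: cvg_cst.
  exact: cvg_scale_right.
have yx0 : 0 < `|y - x| by rewrite normr_gt0 subr_eq0.
have nA := inward_interior nn.
have /cvgrPdist_lt/(_ _ yx0) nyx := ty.
near=> t.
have At : A° (y - t *: n) by near: t.
have tx : y - t *: n != x.
  apply/eqP => tx; have : `|y - (y - t *: n)| < `|y - x| by near: t.
  by rewrite tx ltxx.
rewrite /normal_quotient (outward_normalE nn) /= (SE y)// (SE (y - t *: n))//.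
  transitivity ((G x y - G x (y - t *: n)) / t - (F x y - F x (y - t *: n)) / t) => //.
  by rewrite -mulrBl; congr (_ / _); ring.
exact: interior_subset.
Unshelve. all: by end_near. Qed.


Theorem corollary3p4 (R : realType)
  (Omega U : set (R3 R)) (m : nat) (phi : 'I_m -> R2 R -> R3 R)
  (G S Rg : R3 R -> R3 R -> R) (f u : R3 R -> R)
  (OmegaD : bounded_closed_domain Omega)
  (OmegaB : piecewise_smooth_boundary Omega phi)
  (greenG : dirichlet_green Omega G)
  (GSR : green_decomposition Omega G S Rg)
  (Uopen : open U) (Uconn : connected U) (OmegaU : Omega `<=` U)
  (Rreg : regular_part phi U Omega Rg)
  (Rharm : forall y, Omega y -> harmonic_on U (fun x => Rg x y))
  (fL2 : surface_L2 phi f)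
  (uD : dirichlet_problem phi Omega f u)
  (uG : green_representation phi Omega G f u) :
  let HS := layer phi Omega S f in
  let HR := layer phi Omega Rg f in
  [/\ forall x, Omega° x ->
        [/\ layer_defined phi Omega S f x, layer_defined phi Omega Rg f x &
            u x = HS x + HR x],
      (forall x, U x -> layer_defined phi Omega Rg f x) /\ harmonic_on U HR &
      exists h, harmonic_on U h /\ forall x, Omega° x -> u x - HS x = h x].
Proof.
move=> HS HR.
have [Rdef HRh] := regular_layer OmegaD OmegaB Uopen Rreg Rharm fL2.
have [_ _ _ _ nB] := OmegaB.
have main x : Omega° x -> [/\ layer_defined phi Omega S f x,
    layer_defined phi Omega Rg f x & u x = HS x + HR x].
  move=> Ox; have Ux : U x by apply: OmegaU; exact: interior_subset.
  have [[Gd Gi] ->] := uG x Ox.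
  have [Rd Ri] := Rdef x Ux.
  have Scvg y : smooth_boundary_points phi y ->
      normal_quotient Omega (S x) y t @[t --> 0^'+] -->
      normal_derivative Omega (G x) y - normal_derivative Omega (Rg x) y.
    move=> sy; have By := smooth_boundary_sub OmegaB sy.
    have [i _ [p Ep py]] := sy.
    apply: (singular_normal_quotient GSR Ox _ _ _ (Gd y sy) (Rd y sy)).
    - exact: (boundary_sub OmegaD).
    - by case: By.
    - by rewrite -py; exact: nB.
  have SE y : smooth_boundary_points phi y -> normal_derivative Omega (S x) y =
      normal_derivative Omega (G x) y - normal_derivative Omega (Rg x) y.
    by move=> sy; apply: cvg_lim => //; exact: Scvg.
  have mE := @measurable_osquare R.
  have kernelE i : {in osquare (R:=R), forall p,
      normal_derivative Omega (S x) (phi i p) * f (phi i p) * area_density (phi i) p =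
      normal_derivative Omega (G x) (phi i p) * f (phi i p) * area_density (phi i) p -
      normal_derivative Omega (Rg x) (phi i p) * f (phi i p) * area_density (phi i) p}.
    move=> p; rewrite inE => Ep; rewrite SE; first by rewrite !mulrBl.
    by exists i => //; exists p.
  split => //; last first.
    rewrite /HS /HR /layer /surface_integral -opprD -big_split/=; congr (- _).
    apply: eq_bigr => i _.
    (* The identity is proved as S = G - R, because integrability is at hand for [G] and [Rg]. *)
    apply/eqP; rewrite -subr_eq -(RintegralB mE (Gi i) (Ri i)); apply/eqP.
    by apply: eq_Rintegral => p Ep; rewrite kernelE.
  split; first by move=> y sy; apply/cvg_ex; eexists; exact: Scvg.
  move=> i; have := integrableB mE (Gi i) (Ri i).
  by apply: eq_integrable => // p Ep; rewrite kernelE.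
split => //.
by exists HR; split=> // x Ox; have [_ _ ->] := main x Ox; rewrite addrC addKr.
Qed.
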